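(* Let $E$ and $F$ be sequence functors (with index sets $\Gamma_E$ and $\Gamma_F$) and let $X$ be an infinite dimensional Banach space. If $$\bigcap_{p \in \Gamma_E}E(p,\mathbb{K}) - \bigcup_{q \in \Gamma_F}F(q,\mathbb{K}) \neq \emptyset,$$ then for every $p \in \Gamma_E$ the set $$\bigcap_{r \in \Gamma_E} E(r,X) - \bigcup_{q \in \Gamma_F}F(q,X)$$ is maximal spaceable in the topological vector space $E(p,X)$; i.e. its union with $\{0\}$ contains a closed linear subspace of $E(p,X)$ whose (algebraic) dimension equals $\dim E(p,X)$.
   Context: $\mathbb{K}=\mathbb{R}$ or $\mathbb{C}$; all linear spaces are over $\mathbb{K}$. For a Banach space $X$, $X^{\mathbb{N}}$ denotes the space of all $X$-valued sequences with coordinatewise operations. For subsets $A,B\subseteq X^{\mathbb{N}}$, $A-B := A\cap (X^{\mathbb{N}}\setminus B)$. For $a=(a_n)_{n}\in\mathbb{K}^{\mathbb{N}}$ and $x\in X$, $a\otimes x := (a_n x)_{n=1}^\infty\in X^{\mathbb{N}}$. A subset $A$ of a topological vector space $V$ is $\mu$-spaceable ($\mu$ a cardinal) if $A\cup\{0\}$ contains a closed $\mu$-dimensional linear subspace of $V$; it is maximal spaceable if it is $\dim V$-spaceable. Sequence functor: Let $\mathcal{B}$ be the class of all Banach spaces over $\mathbb{K}$. A sequence functor $E$ consists of a non-empty index set $\Gamma_E$ and an assignment to each $(p,X)\in\Gamma_E\times\mathcal{B}$ of a topological vector space $E(p,X)$ together with either a metric or a family of seminorms generating its topology, such that: (a)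 Exactly one of the following holds uniformly: (a1) for all $p\in\Gamma_E$ and $X\in\mathcal{B}$, $E(p,X)$ is metrizable and comes with a translation invariant metric $d_{E(p,X)}$ inducing its (linear) topology; or (a2) for all $p\in\Gamma_E$ and $X\in\mathcal{B}$, $E(p,X)$ is locally convex and comes with a family of seminorms inducing its topology. (b) For all $p\in\Gamma_E$ and $X\in\mathcal{B}$, $E(p,X)$ is a linear subspace of $X^{\mathbb{N}}$ (coordinatewise operations), and for all $a\in\mathbb{K}^{\mathbb{N}}$ and $x\in X$ with $x\neq 0$: $a\otimes x\in E(p,X)$ if and only if $a\in E(p,\mathbb{K})$. (c) For each $p\in\Gamma_E$ and each infinite dimensional $X\in\mathcal{B}$: (c1) in case (a1), there are constants $L_{X,p},M_{X,p}>0$ with $L_{X,p}\|x\|\,d_{E(p,\mathbb{K})}(a,0)\le d_{E(p,X)}(a\otimes x,0)\le M_{X,p}\|x\|\,d_{E(p,\mathbb{K})}(a,0)$ for all $a\in E(p,\mathbb{K})$, $x\in X$; (c2) in case (a2), there are a constant $K_{X,p}>0$ and a continuous seminorm $\alpha_{E(p,X)}$ from the given family such that $\|w_j\|_X\le K_{X,p}\,\alpha_{E(p,X)}(w)$ for all $w=(w_n)_n\in E(p,X)$ and all $j\in\mathbb{N}$. When $\Gamma_E$ is a singleton one writes simply $E(X)$. *)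

(* Defs.v *)
From Stdlib Require Import Reals Lra Psatz List.
Set Implicit Arguments.
Open Scope R_scope.

Record CC := mkC { Cre : R; Cim : R }.
Definition Cadd (z w : CC) := mkC (Cre z + Cre w) (Cim z + Cim w).
Definition Cmul (z w : CC) :=
  mkC (Cre z * Cre w - Cim z * Cim w) (Cre z * Cim w + Cim z * Cre w).
Definition Copp (z : CC) := mkC (- Cre z) (- Cim z).
Definition C0 := mkC 0 0.
Definition C1 := mkC 1 0.
Definition Cmod (z : CC) := sqrt (Cre z * Cre z + Cim z * Cim z).

Inductive Kind := KReal | KComplex.

Definition Kt (k : Kind) : Type := match k with KReal => R | KComplex => CC end.
Definition Kadd (k : Kind) : Kt k -> Kt k -> Kt k :=
  match k return Kt k -> Kt k -> Kt k with KReal => Rplus | KComplex => Cadd end.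
Definition Kmul (k : Kind) : Kt k -> Kt k -> Kt k :=
  match k return Kt k -> Kt k -> Kt k with KReal => Rmult | KComplex => Cmul end.
Definition Kopp (k : Kind) : Kt k -> Kt k :=
  match k return Kt k -> Kt k with KReal => Ropp | KComplex => Copp end.
Definition Kzero (k : Kind) : Kt k :=
  match k return Kt k with KReal => 0 | KComplex => C0 end.
Definition Kone (k : Kind) : Kt k :=
  match k return Kt k with KReal => 1 | KComplex => C1 end.
Definition Kabs (k : Kind) : Kt k -> R :=
  match k return Kt k -> R with KReal => Rabs | KComplex => Cmod end.

Record Banach (k : Kind) := {
  bcar :> Type;
  badd : bcar -> bcar -> bcar;
  bzero : bcar;
  bopp : bcar -> bcar;
  bscal : Kt k -> bcar -> bcar;
  bnorm : bcar -> R;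
  badd_assoc : forall x y z, badd x (badd y z) = badd (badd x y) z;
  badd_comm : forall x y, badd x y = badd y x;
  badd_0 : forall x, badd x bzero = x;
  badd_opp : forall x, badd x (bopp x) = bzero;
  bscal_1 : forall x, bscal (Kone k) x = x;
  bscal_assoc : forall a b x, bscal a (bscal b x) = bscal (Kmul k a b) x;
  bscal_distr_v : forall a x y, bscal a (badd x y) = badd (bscal a x) (bscal a y);
  bscal_distr_k : forall a b x, bscal (Kadd k a b) x = badd (bscal a x) (bscal b x);
  bnorm_eq0 : forall x, bnorm x = 0 -> x = bzero;
  bnorm_scal : forall a x, bnorm (bscal a x) = Kabs k a * bnorm x;
  bnorm_triangle : forall x y, bnorm (badd x y) <= bnorm x + bnorm y;
  bcomplete : forall u : nat -> bcar,
    (forall eps, 0 < eps -> exists N, forall m n, (N <= m)%nat -> (N <= n)%nat ->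
        bnorm (badd (u m) (bopp (u n))) < eps) ->
    exists l, forall eps, 0 < eps -> exists N, forall n, (N <= n)%nat ->
        bnorm (badd (u n) (bopp l)) < eps
}.

Lemma Cext (z w : CC) : Cre z = Cre w -> Cim z = Cim w -> z = w.
Proof. destruct z, w; simpl; intros; subst; reflexivity. Qed.

Ltac csolve := intros; repeat match goal with z : CC |- _ => destruct z end;
  apply Cext; simpl; ring.

Lemma Kb_add_assoc k : forall x y z : Kt k, Kadd k x (Kadd k y z) = Kadd k (Kadd k x y) z.
Proof. destruct k; simpl; [intros; ring | csolve]. Qed.
Lemma Kb_add_comm k : forall x y : Kt k, Kadd k x y = Kadd k y x.
Proof. destruct k; simpl; [intros; ring | csolve]. Qed.
Lemma Kb_add_0 k : forall x : Kt k, Kadd k x (Kzero k) = x.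
Proof. destruct k; simpl; [intros; ring | csolve]. Qed.
Lemma Kb_add_opp k : forall x : Kt k, Kadd k x (Kopp k x) = Kzero k.
Proof. destruct k; simpl; [intros; ring | csolve]. Qed.
Lemma Kb_scal_1 k : forall x : Kt k, Kmul k (Kone k) x = x.
Proof. destruct k; simpl; [intros; ring | csolve]. Qed.
Lemma Kb_scal_assoc k : forall a b x : Kt k, Kmul k a (Kmul k b x) = Kmul k (Kmul k a b) x.
Proof. destruct k; simpl; [intros; ring | csolve]. Qed.
Lemma Kb_distr_v k : forall a x y : Kt k,
  Kmul k a (Kadd k x y) = Kadd k (Kmul k a x) (Kmul k a y).
Proof. destruct k; simpl; [intros; ring | csolve]. Qed.
Lemma Kb_distr_k k : forall a b x : Kt k,
  Kmul k (Kadd k a b) x = Kadd k (Kmul k a x) (Kmul k b x).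
Proof. destruct k; simpl; [intros; ring | csolve]. Qed.

Lemma Cmod_ge0 z : 0 <= Cmod z.
Proof. apply sqrt_pos. Qed.

Lemma Cmod_sq z : Cmod z * Cmod z = Cre z * Cre z + Cim z * Cim z.
Proof. unfold Cmod; apply sqrt_sqrt; nra. Qed.

Lemma Kb_norm_eq0 k : forall x : Kt k, Kabs k x = 0 -> x = Kzero k.
Proof.
  destruct k; simpl.
  - intros x H. destruct (Req_dec x 0) as [->|Hx]; [reflexivity|].
    exfalso; apply (Rabs_no_R0 x Hx H).
  - intros z H. pose proof (Cmod_sq z) as Hs. rewrite H in Hs.
    apply Cext; simpl; nra.
Qed.

Lemma Kb_norm_scal k : forall a x : Kt k, Kabs k (Kmul k a x) = Kabs k a * Kabs k x.
Proof.
  destruct k; simpl.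
  - apply Rabs_mult.
  - intros a x. unfold Cmod. rewrite <- sqrt_mult by nra. f_equal. simpl. ring.
Qed.

Lemma Kb_triangle k : forall x y : Kt k, Kabs k (Kadd k x y) <= Kabs k x + Kabs k y.
Proof.
  destruct k; simpl.
  - apply Rabs_triang.
  - intros z w.
    pose proof (Cmod_sq z) as Hz; pose proof (Cmod_sq w) as Hw;
    pose proof (Cmod_sq (Cadd z w)) as Hzw.
    pose proof (Cmod_ge0 z); pose proof (Cmod_ge0 w); pose proof (Cmod_ge0 (Cadd z w)).
    unfold Cadd in *. simpl Cre in *; simpl Cim in *.
    set (s := Cmod (mkC (Cre z + Cre w) (Cim z + Cim w))) in *.
    set (s1 := Cmod z) in *. set (s2 := Cmod w) in *.
    destruct z as [a b], w as [c d]; simpl Cre in *; simpl Cim in *.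
    assert (Hcs : a * c + b * d <= s1 * s2).
    { assert ((a*c+b*d)*(a*c+b*d) <= (s1 * s2) * (s1 * s2)).
      { replace ((s1 * s2) * (s1 * s2)) with ((s1 * s1) * (s2 * s2)) by ring.
        rewrite Hz, Hw. pose proof (pow2_ge_0 (a*d-b*c)). nra. }
      assert (0 <= s1 * s2) by (apply Rmult_le_pos; assumption).
      destruct (Rle_dec (a*c+b*d) 0); [lra|].
      nra. }
    nra.
Qed.

Lemma Rabs_le_Cmod_re z : Rabs (Cre z) <= Cmod z.
Proof.
  pose proof (Cmod_sq z); pose proof (Cmod_ge0 z).
  unfold Rabs; destruct Rcase_abs; nra.
Qed.
Lemma Rabs_le_Cmod_im z : Rabs (Cim z) <= Cmod z.
Proof.
  pose proof (Cmod_sq z); pose proof (Cmod_ge0 z).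
  unfold Rabs; destruct Rcase_abs; nra.
Qed.
Lemma Cmod_le z : Cmod z <= Rabs (Cre z) + Rabs (Cim z).
Proof.
  pose proof (Cmod_sq z); pose proof (Cmod_ge0 z).
  pose proof (Rabs_pos (Cre z)); pose proof (Rabs_pos (Cim z)).
  assert (Rabs (Cre z) * Rabs (Cre z) = Cre z * Cre z) by
    (rewrite <- Rabs_mult; apply Rabs_pos_eq; nra).
  assert (Rabs (Cim z) * Rabs (Cim z) = Cim z * Cim z) by
    (rewrite <- Rabs_mult; apply Rabs_pos_eq; nra).
  destruct (Rle_dec (Cmod z) (Rabs (Cre z) + Rabs (Cim z))); [assumption|].
  nra.
Qed.

Lemma R_cauchy_conv (u : nat -> R) :
  (forall eps, 0 < eps -> exists N, forall m n, (N <= m)%nat -> (N <= n)%nat ->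
        Rabs (u m + - u n) < eps) ->
  exists l, forall eps, 0 < eps -> exists N, forall n, (N <= n)%nat -> Rabs (u n + - l) < eps.
Proof.
  intros H. assert (Hc : Cauchy_crit u).
  { intros eps He. destruct (H eps He) as [N HN]. exists N. intros m n Hm Hn.
    unfold R_dist, Rminus. apply HN; lia. }
  destruct (R_complete u Hc) as [l Hl]. exists l.
  intros eps He. destruct (Hl eps He) as [N HN]. exists N. intros n Hn.
  specialize (HN n Hn). unfold R_dist, Rminus in HN. exact HN.
Qed.

Lemma Kb_complete k : forall u : nat -> Kt k,
    (forall eps, 0 < eps -> exists N, forall m n, (N <= m)%nat -> (N <= n)%nat ->
        Kabs k (Kadd k (u m) (Kopp k (u n))) < eps) ->
    exists l, forall eps, 0 < eps -> exists N, forall n, (N <= n)%nat ->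
        Kabs k (Kadd k (u n) (Kopp k l)) < eps.
Proof.
  destruct k; simpl.
  - apply R_cauchy_conv.
  - intros u H.
    destruct (R_cauchy_conv (fun n => Cre (u n))) as [lr Hr].
    { intros eps He. destruct (H eps He) as [N HN]. exists N. intros m n Hm Hn.
      eapply Rle_lt_trans; [|apply (HN m n Hm Hn)].
      apply (Rabs_le_Cmod_re (Cadd (u m) (Copp (u n)))). }
    destruct (R_cauchy_conv (fun n => Cim (u n))) as [li Hi].
    { intros eps He. destruct (H eps He) as [N HN]. exists N. intros m n Hm Hn.
      eapply Rle_lt_trans; [|apply (HN m n Hm Hn)].
      apply (Rabs_le_Cmod_im (Cadd (u m) (Copp (u n)))). }
    exists (mkC lr li). intros eps He.
    destruct (Hr (eps/2) ltac:(lra)) as [N1 H1].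
    destruct (Hi (eps/2) ltac:(lra)) as [N2 H2].
    exists (Nat.max N1 N2). intros n Hn.
    eapply Rle_lt_trans; [apply Cmod_le|]. simpl.
    specialize (H1 n ltac:(lia)); specialize (H2 n ltac:(lia)). simpl in *. lra.
Qed.

Definition Kban (k : Kind) : Banach k := {|
  bcar := Kt k; badd := Kadd k; bzero := Kzero k; bopp := Kopp k;
  bscal := Kmul k; bnorm := Kabs k;
  badd_assoc := Kb_add_assoc k; badd_comm := Kb_add_comm k;
  badd_0 := Kb_add_0 k; badd_opp := Kb_add_opp k;
  bscal_1 := Kb_scal_1 k; bscal_assoc := Kb_scal_assoc k;
  bscal_distr_v := Kb_distr_v k; bscal_distr_k := Kb_distr_k k;
  bnorm_eq0 := Kb_norm_eq0 k; bnorm_scal := Kb_norm_scal k;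
  bnorm_triangle := Kb_triangle k; bcomplete := Kb_complete k |}.

Section Seq.
Variable k : Kind.
Variable X : Banach k.

Definition sadd (u v : nat -> X) : nat -> X := fun n => badd X (u n) (v n).
Definition sscal (a : Kt k) (u : nat -> X) : nat -> X := fun n => bscal X a (u n).
Definition sopp (u : nat -> X) : nat -> X := fun n => bopp X (u n).
Definition szero : nat -> X := fun _ => bzero X.

Definition ktensor (a : nat -> Kt k) (x : X) : nat -> X := fun n => bscal X (a n) x.

Definition lin_subspace (S : (nat -> X) -> Prop) : Prop :=
  S szero /\ (forall u v, S u -> S v -> S (sadd u v)) /\
  (forall a u, S u -> S (sscal a u)).

Fixpoint lincomb (l : list (Kt k * (nat -> X))) : nat -> X :=
  match l with
  | nil => szero
  | (c, v) :: t => sadd (sscal c v) (lincomb t)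
  end.

Definition lin_indep (B : (nat -> X) -> Prop) : Prop :=
  forall l : list (Kt k * (nat -> X)),
    NoDup (map snd l) -> (forall v, In v (map snd l) -> B v) ->
    lincomb l = szero -> forall c, In c (map fst l) -> c = Kzero k.

Definition spans (B S : (nat -> X) -> Prop) : Prop :=
  forall w, S w -> exists l : list (Kt k * (nat -> X)),
    (forall v, In v (map snd l) -> B v) /\ lincomb l = w.

Definition hamel_basis (B S : (nat -> X) -> Prop) : Prop :=
  (forall v, B v -> S v) /\ lin_indep B /\ spans B S.

Fixpoint Xlincomb (l : list (Kt k * X)) : X :=
  match l with
  | nil => bzero X
  | (c, v) :: t => badd X (bscal X c v) (Xlincomb t)
  end.

Definition infinite_dim : Prop :=
  ~ exists l : list X, forall x : X, exists cl : list (Kt k * X),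
      (forall v, In v (map snd cl) -> In v l) /\ x = Xlincomb cl.

End Seq.

Arguments szero {k X}.
Arguments sadd {k X}. Arguments sscal {k X}. Arguments sopp {k X}.
Arguments ktensor {k X}. Arguments lin_subspace {k X}. Arguments lincomb {k X}.
Arguments lin_indep {k X}. Arguments spans {k X}. Arguments hamel_basis {k X}.
Arguments Xlincomb {k X}. Arguments infinite_dim {k}.

Definition equipotent {T : Type} (P Q : T -> Prop) : Prop :=
  exists f : sig P -> sig Q,
    (forall a b, f a = f b -> a = b) /\ (forall c, exists a, f a = c).

Definition same_dim {k : Kind} {X : Banach k} (S1 S2 : (nat -> X) -> Prop) : Prop :=
  exists B1 B2 : (nat -> X) -> Prop,
    hamel_basis B1 S1 /\ hamel_basis B2 S2 /\ equipotent B1 B2.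

Definition metric_on {T : Type} (S : T -> Prop) (d : T -> T -> R) : Prop :=
  (forall x y, S x -> S y -> 0 <= d x y /\ (d x y = 0 <-> x = y) /\ d x y = d y x) /\
  (forall x y z, S x -> S y -> S z -> d x z <= d x y + d y z).

Definition seminorm_on {k : Kind} {X : Banach k} (S : (nat -> X) -> Prop)
  (s : (nat -> X) -> R) : Prop :=
  (forall u, S u -> 0 <= s u) /\
  (forall a u, S u -> s (sscal a u) = Kabs k a * s u) /\
  (forall u v, S u -> S v -> s (sadd u v) <= s u + s v).

Unset Implicit Arguments.
Record SeqFunctor (k : Kind) := {
  Gam : Type;
  Gam_inh : inhabited Gam;
  Esp : Gam -> forall X : Banach k, (nat -> X) -> Prop;
  Esp_subspace : forall p X, lin_subspace (Esp p X);
  is_metric : bool;                             (* true: case (a1); false: case (a2) *)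
  edist : Gam -> forall X : Banach k, (nat -> X) -> (nat -> X) -> R;
  SIdx : Gam -> Banach k -> Type;
  esemi : forall p X, SIdx p X -> (nat -> X) -> R;
  (* (a1): translation invariant metric inducing a linear topology *)
  ax_a1 : is_metric = true -> forall p (X : Banach k),
    metric_on (Esp p X) (edist p X) /\
    (forall u v w, Esp p X u -> Esp p X v -> Esp p X w ->
        edist p X (sadd u w) (sadd v w) = edist p X u v) /\
    (forall (a0 : Kt k) u0, Esp p X u0 -> forall eps, 0 < eps ->
       exists del, 0 < del /\ forall a u, Esp p X u ->
         Kabs k (Kadd k a (Kopp k a0)) < del -> edist p X u u0 < del ->
         edist p X (sscal a u) (sscal a0 u0) < eps);
  (* (a2): locally convex, topology given by a family of seminorms *)
  ax_a2 : is_metric = false -> forall p (X : Banach k) (i : SIdx p X),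
    seminorm_on (Esp p X) (esemi p X i);
  ax_b : forall p (X : Banach k) (a : nat -> Kt k) (x : X), x <> bzero X ->
    (Esp p X (ktensor a x) <-> Esp p (Kban k) a);
  ax_c1 : is_metric = true -> forall p (X : Banach k), infinite_dim X ->
    exists L M, 0 < L /\ 0 < M /\
      forall (a : nat -> Kt k) (x : X), Esp p (Kban k) a ->
        L * bnorm X x * edist p (Kban k) a szero <= edist p X (ktensor a x) szero /\
        edist p X (ktensor a x) szero <= M * bnorm X x * edist p (Kban k) a szero;
  ax_c2 : is_metric = false -> forall p (X : Banach k), infinite_dim X ->
    exists (C : R) (i : SIdx p X), 0 < C /\
      forall w j, Esp p X w -> bnorm X (w j) <= C * esemi p X i w
}.

Arguments Gam {k}. Arguments Gam_inh {k}. Arguments Esp {k}. Arguments Esp_subspace {k}.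
Arguments is_metric {k}. Arguments edist {k}. Arguments SIdx {k}. Arguments esemi {k}.
Arguments ax_a1 {k}. Arguments ax_a2 {k}. Arguments ax_b {k}. Arguments ax_c1 {k}.
Arguments ax_c2 {k}.
Set Implicit Arguments.

(** x lies in the closure (in E(p,X)) of W: every basic neighbourhood of x meets W *)
Definition in_closure {k : Kind} (E : SeqFunctor k) (p : Gam E) (X : Banach k)
  (W : (nat -> X) -> Prop) (x : nat -> X) : Prop :=
  if is_metric E then
    forall eps, 0 < eps -> exists y, W y /\ edist E p X x y < eps
  else
    forall (l : list (SIdx E p X)) eps, 0 < eps ->
      exists y, W y /\ forall i, In i l -> esemi E p X i (sadd y (sopp x)) < eps.

Definition closed_in {k : Kind} (E : SeqFunctor k) (p : Gam E) (X : Banach k)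
  (W : (nat -> X) -> Prop) : Prop :=
  forall x, Esp E p X x -> in_closure E p X W x -> W x.

Definition maximal_spaceable {k : Kind} (E : SeqFunctor k) (p : Gam E) (X : Banach k)
  (A : (nat -> X) -> Prop) : Prop :=
  exists W : (nat -> X) -> Prop,
    (forall w, W w -> Esp E p X w) /\
    lin_subspace W /\
    closed_in E p X W /\
    (forall w, W w -> A w \/ w = szero) /\
    same_dim W (Esp E p X).

(* Main.v *)
(** Fix [a] in every [E(r, K)] and in no [F(q, K)]. The space [W] of the sequences
    [a \otimes x] meets every [F(q, X)] only in [0], and (c) makes [W] closed in [E(p, X)].
    It remains to see that [dim W = dim X] is as large as the cardinality of [X^N].

    First, [X^N] injects into [X]: if [S] is a maximal 1/2-separated subset of the unit
    ball, then [X] injects into [S^N] by iterated approximation, and [S^N] injects into [X]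
    by [s |-> sum_n 8^-n s_n]. Secondly, [X] contains a linearly independent family
    [y_t = sum_n t^n z_n] indexed by real [t], where [z_n] decays fast compared with its
    distance to the span of the earlier terms: a bounded coefficient sequence [b] with
    [sum_n b_n z_n = 0] vanishes, and a Vandermonde argument concludes. Hence a Hamel basis
    [B] of [W] containing the [a \otimes y_t] satisfies [|K| <= |B|], so
    [|X^N| <= |X| <= |list (K * B)| <= |B|] by Hessenberg's theorem. *)

Require Import Defs.
From Stdlib Require Import Reals Lra Lia List FinFun Cantor.
From Stdlib Require Import Classical IndefiniteDescription.
From Stdlib Require Import FunctionalExtensionality PropExtensionality.
From mathcomp Require classical_sets cardinality.
Set Implicit Arguments.
Set Bullet Behavior "Strict Subproofs".

(** * Zorn's lemma and cardinal comparisons *)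

(** Zorn's lemma is applied to the sets [A] with [P (A0 \/ A)]. The empty chain then corresponds to
    [A0] itself, so only nonempty chains have to be treated by the caller. *)
Lemma zorn_subsets_above (T : Type) (P : (T -> Prop) -> Prop) (A0 : T -> Prop) :
  P A0 ->
  (forall C : (T -> Prop) -> Prop,
     (exists A, C A) -> (forall A, C A -> P A) ->
     (forall A B, C A -> C B -> (forall x, A x -> B x) \/ (forall x, B x -> A x)) ->
     P (fun x => exists A, C A /\ A x)) ->
  exists M, P M /\ (forall x, A0 x -> M x) /\
    forall B, P B -> (forall x, M x -> B x) -> forall x, B x -> M x.
Proof.
  intros P0 Pchain.
  destruct (@classical_sets.Zorn_bigcup T (fun A => P (fun x => A0 x \/ A x)))
    as [M [PM maxM]].
  - intros C CP Ctot.
    destruct (classic (exists A, C A)) as [[A1 CA1]|Cempty].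
    + set (C' := fun B => exists A, C A /\ B = fun x : T => A0 x \/ A x).
      assert (H : P (fun x => exists B, C' B /\ B x)).
      { apply Pchain.
        - exists (fun x => A0 x \/ A1 x), A1. auto.
        - intros B [A [CA ->]]. apply (CP A CA).
        - intros B B' [A [CA ->]] [A' [CA' ->]].
          destruct (Ctot A A' CA CA') as [H|H];
            [left|right]; intros x [Hx|Hx]; auto; right; apply H, Hx. }
      replace (fun x => A0 x \/ _) with (fun x => exists B, C' B /\ B x); [exact H|].
      apply functional_extensionality; intro x; apply propositional_extensionality; split.
      * intros [B [[A [CA ->]] [Hx|Hx]]]; [left; exact Hx|right].
        exists A; [exact CA|exact Hx].
      * intros [Hx|[A CA Hx]].
        -- exists (fun y => A0 y \/ A1 y); split; [exists A1|]; auto.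
        -- exists (fun y => A0 y \/ A y); split; [exists A|]; auto.
    + replace (fun x => A0 x \/ _) with A0; [exact P0|].
      apply functional_extensionality; intro x; apply propositional_extensionality; split.
      * auto.
      * intros [Hx|[A CA _]]; [exact Hx|]. exfalso; eauto.
  - exists (fun x => A0 x \/ M x). split; [exact PM|]. split; [auto|].
    intros B PB MB x Bx. apply NNPP; intro Hx.
    apply (maxM B).
    + split; [intros y My; apply MB; auto|]. intro H; apply Hx; right; apply H, Bx.
    + replace (fun y => A0 y \/ B y) with B; [exact PB|].
      apply functional_extensionality; intro y; apply propositional_extensionality; split.
      * auto.
      * intros [Hy|Hy]; [apply MB|]; auto.
Qed.

Lemma proj1_sig_inj (T : Type) (P : T -> Prop) (x y : sig P) :
  proj1_sig x = proj1_sig y -> x = y.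
Proof. apply eq_sig_hprop. intros; apply proof_irrelevance. Qed.

Definition injects (U V : Type) : Prop := exists f : U -> V, Injective f.

Lemma injects_trans (U V Z : Type) : injects U V -> injects V Z -> injects U Z.
Proof. intros [f Hf] [g Hg]. exists (fun x => g (f x)). intros x y H; auto. Qed.

Lemma injects_prod (U U' V V' : Type) :
  injects U U' -> injects V V' -> injects (U * V) (U' * V').
Proof.
  intros [f Hf] [g Hg]. exists (fun p => (f (fst p), g (snd p))).
  intros [x y] [x' y'] H. injection H; intros. f_equal; auto.
Qed.

Lemma injects_sequences (U V : Type) : injects U V -> injects (nat -> U) (nat -> V).
Proof.
  intros [f Hf]. exists (fun u n => f (u n)). intros u v H.
  apply functional_extensionality; intro n. apply Hf. exact (equal_f H n).
Qed.

Lemma sequences_of_sequences_injects (U : Type) : injects (nat -> nat -> U) (nat -> U).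
Proof.
  exists (fun u n => u (fst (of_nat n)) (snd (of_nat n))). intros u v H.
  apply functional_extensionality; intro i; apply functional_extensionality; intro j.
  pose proof (equal_f H (to_nat (i, j))) as E. cbv beta in E.
  rewrite cancel_of_to in E. exact E.
Qed.

Lemma cantor_bernstein (U V : Type) :
  injects U V -> injects V U ->
  exists h : U -> V, (forall x y, h x = h y -> x = y) /\ (forall z, exists x, h x = z).
Proof.
  intros [f Hf] [g Hg].
  assert (H : forall (T T' : Type) (j : T -> T'), Injective j ->
    is_true (cardinality.card_le (@classical_sets.setT T) (@classical_sets.setT T'))).
  { intros T T' j Hj.
    destruct (proj2 (@cardinality.injfunPex T T' classical_sets.setT classical_sets.setT))
      as [F].
    - exists j; [intros x _; exact I|]. intros x y _ _ E; exact (Hj _ _ E).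
    - exact (cardinality.inj_card_le F). }
  pose proof (cardinality.Cantor_Bernstein (H _ _ f Hf) (H _ _ g Hg)) as E.
  apply (ssrbool.elimT cardinality.card_bijP) in E. destruct E as [h [h' Hh Hh']].
  (* The bijection obtained is between the subtypes of the full sets; [top] and [proj1_sig]
     transport it back to [U] and [V]. *)
  set (top := fun T (x : T) => exist _ x (@classical_sets.mem_set T classical_sets.setT x I)
    : classical_sets.set_type (@classical_sets.setT T)).
  assert (Etop : forall T z, top T (proj1_sig z) = z).
  { intros T [z Hz]. apply proj1_sig_inj; reflexivity. }
  exists (fun x => proj1_sig (h (top U x))). split.
  - intros x y Exy. apply proj1_sig_inj in Exy.
    apply (f_equal h') in Exy. rewrite !Hh in Exy. exact (f_equal (@proj1_sig _ _) Exy).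
  - intro z. exists (proj1_sig (h' (top V z))).
    rewrite Etop, Hh'. reflexivity.
Qed.

(** A maximal graph of a partial injection exists by Zorn. If it missed some [u0] on the left and
    some [v0] on the right, the pair [(u0, v0)] could be added. *)
Lemma injects_total (U V : Type) : injects U V \/ injects V U.
Proof.
  destruct (@zorn_subsets_above (U * V)
    (fun G => (forall u v v', G (u, v) -> G (u, v') -> v = v') /\
              (forall u u' v, G (u, v) -> G (u', v) -> u = u')) (fun _ => False))
    as [G [[Gfun Ginj] [_ Gmax]]].
  - split; contradiction.
  - intros C _ CP Ctot. split.
    + intros u v v' [A [CA HA]] [B [CB HB]].
      destruct (Ctot A B CA CB) as [H|H];
        [apply (proj1 (CP B CB) u)|apply (proj1 (CP A CA) u)]; auto.
    + intros u u' v [A [CA HA]] [B [CB HB]].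
      destruct (Ctot A B CA CB) as [H|H];
        [apply (proj2 (CP B CB) u u' v)|apply (proj2 (CP A CA) u u' v)]; auto.
  - destruct (classic (forall u, exists v, G (u, v))) as [Hdom|Hdom].
    { left. destruct (functional_choice _ Hdom) as [f Hf]. exists f.
      intros u u' E. apply (Ginj u u' (f u)); [apply Hf|rewrite E; apply Hf]. }
    destruct (classic (forall v, exists u, G (u, v))) as [Hran|Hran].
    { right. destruct (functional_choice _ Hran) as [f Hf]. exists f.
      intros v v' E. apply (Gfun (f v)); [apply Hf|rewrite E; apply Hf]. }
    apply not_all_ex_not in Hdom as [u0 Hu]. apply not_all_ex_not in Hran as [v0 Hv].
    exfalso. apply Hu. exists v0.
    apply (Gmax (fun p => G p \/ p = (u0, v0))); [split|auto|auto].
    + intros u v v' [H|H] [H'|H']; [eauto| | |congruence];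
        exfalso; apply Hu; [injection H' as -> ->|injection H as -> ->]; eauto.
    + intros u u' v [H|H] [H'|H']; [eauto| | |congruence];
        exfalso; apply Hv; [injection H' as -> ->|injection H as -> ->]; eauto.
Qed.

(* Hessenberg's theorem: a maximal injection [A * A -> A] with [A] a subset of [T]
   exists by Zorn, and it could be extended if [A] injected into its complement. *)
Lemma injects_square (T : Type) : injects nat T -> injects (T * T) T.
Proof.
  intros [nu Hnu].
  (* [P G] says that [G] is the graph of an injection [A * A -> A] with [A = fld G]. Since [A] is
     read off from the first coordinates, Zorn's lemma can be applied to the graphs alone. *)
  set (fld := fun (G : T * T * T -> Prop) a => exists b c, G ((a, b), c)).
  set (P := fun G : T * T * T -> Prop =>
    (forall x c c', G (x, c) -> G (x, c') -> c = c') /\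
    (forall x x' c, G (x, c) -> G (x', c) -> x = x') /\
    (forall a b, fld G a -> fld G b -> exists c, G ((a, b), c)) /\
    (forall a b c, G ((a, b), c) -> fld G b /\ fld G c)).
  (* Cantor's pairing on the image of [nu] is the starting graph; it forces the maximal [A] to be
     infinite. *)
  set (G0 := fun z : T * T * T => exists i j,
     z = ((nu i, nu j), nu (to_nat (i, j)))).
  assert (fld0 : forall i, fld G0 (nu i)).
  { intro i. exists (nu i), (nu (to_nat (i, i))), i, i. reflexivity. }
  destruct (@zorn_subsets_above _ P G0) as [G [[Gfun [Ginj [Gtot Gran]]] [GG0 Gmax]]].
  - split; [|split; [|split]].
    + intros x c c' [i [j E]] [i' [j' E']].
      injection E as -> ->. injection E' as E1 E2 ->.
      apply Hnu in E1, E2. subst. reflexivity.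
    + intros x x' c [i [j E]] [i' [j' E']].
      injection E as -> ->. injection E' as -> E1.
      apply Hnu, (to_nat_inj (i, j) (i', j')) in E1. injection E1 as -> ->. reflexivity.
    + intros a b [b' [c [i [j E]]]] [b'' [c' [i' [j' E']]]].
      injection E as -> -> ->. injection E' as -> -> ->.
      exists (nu (to_nat (i, i'))), i, i'. reflexivity.
    + intros a b c [i [j E]]. injection E as -> -> ->. auto.
  - intros C _ CP Ctot.
    assert (up : forall A a, C A -> fld A a -> fld (fun z => exists A, C A /\ A z) a).
    { intros A a CA [b [c H]]. exists b, c, A. auto. }
    split; [|split; [|split]].
    + intros x c c' [A [CA HA]] [B [CB HB]].
      destruct (Ctot A B CA CB) as [H|H];
        [apply (proj1 (CP B CB) x)|apply (proj1 (CP A CA) x)]; auto.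
    + intros x x' c [A [CA HA]] [B [CB HB]].
      destruct (Ctot A B CA CB) as [H|H];
        [apply (proj1 (proj2 (CP B CB)) x x' c)|apply (proj1 (proj2 (CP A CA)) x x' c)]; auto.
    + intros a b [a' [c [A [CA HA]]]] [b' [d [B [CB HB]]]].
      destruct (Ctot A B CA CB) as [H|H].
      * destruct (proj1 (proj2 (proj2 (CP B CB))) a b) as [e He];
          [exists a', c; auto|exists b', d; auto|exists e, B; auto].
      * destruct (proj1 (proj2 (proj2 (CP A CA))) a b) as [e He];
          [exists a', c; auto|exists b', d; auto|exists e, A; auto].
    + intros a b c [A [CA HA]].
      destruct (proj2 (proj2 (proj2 (CP A CA))) a b c HA) as [H1 H2].
      split; apply (up A); auto.
  - set (A := fld G) in *.
    assert (Anu : forall i, A (nu i)).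
    { intro i. destruct (fld0 i) as [b [c H]]. exists b, c. auto. }
    (* Two distinct tags in [A]: [f (o, _)] and [f (i, _)] embed two disjoint copies of [A] into
       [A]. *)
    set (o := nu 0%nat). set (i := nu 1%nat).
    assert (Hoi : o <> i) by (intro E; apply Hnu in E; discriminate).
    destruct (@functional_choice (T * T) T
      (fun x c => A (fst x) -> A (snd x) -> G (x, c))) as [f Hf].
    { intros [a b]. destruct (classic (A a /\ A b)) as [[Ha Hb]|H].
      - destruct (Gtot a b Ha Hb) as [c Hc]. exists c; auto.
      - exists o. tauto. }
    assert (fA : forall a b, A a -> A b -> A (f (a, b))).
    { intros a b Ha Hb. apply (Gran a b), (Hf (a, b)); auto. }
    assert (finj : forall a b a' b', A a -> A b -> A a' -> A b' ->
       f (a, b) = f (a', b') -> a = a' /\ b = b').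
    { intros a b a' b' Ha Hb Ha' Hb' E.
      assert (E' : (a, b) = (a', b')).
      { apply (Ginj _ _ (f (a, b))); [|rewrite E]; apply (Hf (_, _)); auto. }
      injection E'; auto. }
    (* If [A] injected into its complement by [g'], then [A' = A \/ g'(A)] would inject into [A] by
       a tagged map [phi]. Sending each new pair [(a, b)] to [g' (f (phi a, phi b))], outside the
       old range, extends the graph and contradicts maximality. *)
    destruct (injects_total (sig A) (sig (fun x => ~ A x))) as [[g Hg]|[g Hg]].
    + exfalso.
      destruct (@functional_choice T T (fun x y => forall Hx : A x, y = proj1_sig (g (exist _ x Hx))))
        as [g' Hg'].
      { intro x. destruct (classic (A x)) as [Hx|Hx].
        - exists (proj1_sig (g (exist _ x Hx))). intro Hx'.
          rewrite (proof_irrelevance _ Hx Hx'). reflexivity.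
        - exists x. intro; contradiction. }
      assert (g'A : forall x, A x -> ~ A (g' x)).
      { intros x Hx. rewrite (Hg' x Hx). apply proj2_sig. }
      assert (g'inj : forall x y, A x -> A y -> g' x = g' y -> x = y).
      { intros x y Hx Hy E. rewrite (Hg' x Hx), (Hg' y Hy) in E.
        apply proj1_sig_inj, Hg in E.
        injection E; auto. }
      set (A' := fun x => A x \/ exists y, A y /\ x = g' y).
      destruct (@functional_choice T T (fun x z => A' x ->
        (A x /\ z = f (o, x)) \/ exists y, A y /\ x = g' y /\ z = f (i, y))) as [phi Hphi].
      { intro x. destruct (classic (A' x)) as [[H|[y [Hy E]]]|H].
        - exists (f (o, x)); auto.
        - exists (f (i, y)); right; exists y; auto.
        - exists x; tauto. }
      assert (phiA : forall x, A' x -> A (phi x)).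
      { intros x Hx. destruct (Hphi x Hx) as [[H ->]|[y [Hy [_ ->]]]];
          apply fA; auto; apply Anu. }
      assert (phiinj : forall x y, A' x -> A' y -> phi x = phi y -> x = y).
      { intros x y Hx Hy E.
        destruct (Hphi x Hx) as [[H1 E1]|[x' [H1 [-> E1]]]],
                 (Hphi y Hy) as [[H2 E2]|[y' [H2 [-> E2]]]];
          rewrite E1, E2 in E; apply finj in E; auto; try apply Anu;
          destruct E as [E E']; try congruence. }
      set (G' := fun z => G z \/ (A' (fst (fst z)) /\ A' (snd (fst z)) /\
         ~ (A (fst (fst z)) /\ A (snd (fst z))) /\
         snd z = g' (f (phi (fst (fst z)), phi (snd (fst z)))))).
      assert (fld' : forall a, A' a -> fld G' a).
      { intros a Ha. destruct (classic (A a)) as [H|H].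
        - destruct H as [b [c H]]. exists b, c; left; auto.
        - exists a, (g' (f (phi a, phi a))). right. simpl. tauto. }
      assert (fld'' : forall a, fld G' a -> A' a).
      { intros a [b [c [H|[H _]]]]; [left; exists b, c; auto|exact H]. }
      assert (GA : forall a b c, G ((a, b), c) -> A a /\ A b /\ A c).
      { intros a b c H. split; [exists b, c; auto|]. apply (Gran a b c H). }
      assert (PG' : P G').
      { split; [|split; [|split]].
        - intros [a b] c c' [H|[Ha [Hb [Hn E]]]] [H'|[Ha' [Hb' [Hn' E']]]]; simpl in *.
          + eauto.
          + apply GA in H; tauto.
          + apply GA in H'; tauto.
          + congruence.
        - intros [a b] [a' b'] c [H|[Ha [Hb [Hn E]]]] [H'|[Ha' [Hb' [Hn' E']]]]; simpl in *.
          + eauto.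
          + exfalso. apply GA in H. subst c. apply (g'A (f (phi a', phi b'))); [auto|tauto].
          + exfalso. apply GA in H'. subst c. apply (g'A (f (phi a, phi b))); [auto|tauto].
          + rewrite E in E'. apply g'inj in E'; auto.
            apply finj in E'; auto. destruct E' as [E1 E2].
            apply phiinj in E1, E2; auto. congruence.
        - intros a b Ha%fld'' Hb%fld''.
          destruct (classic (A a /\ A b)) as [[H1 H2]|H].
          + destruct (Gtot a b H1 H2) as [c Hc]. exists c; left; auto.
          + exists (g' (f (phi a, phi b))). right; auto.
        - intros a b c [H|[Ha [Hb [Hn E]]]]; simpl in *.
          + apply GA in H. split; apply fld'; left; tauto.
          + split; apply fld'; [auto|]. right. exists (f (phi a, phi b)). auto. }
      assert (HG : fld G' (g' o)).
      { apply fld'. right. exists o. split; [apply Anu|reflexivity]. }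
      destruct HG as [b [c Hbc]].
      apply (g'A o (Anu 0%nat)). exists b, c.
      apply (Gmax G' PG'); [intros z Hz; left; auto|exact Hbc].
    (* Here the complement of [A] injects into [A], so tagging embeds all of [T] into [A] by [phi],
       and [f] pairs the images. *)
    + destruct (@functional_choice T T (fun x z =>
        (A x /\ z = f (o, x)) \/ exists H : ~ A x, z = f (i, proj1_sig (g (exist _ x H)))))
        as [phi Hphi].
      { intro x. destruct (classic (A x)) as [H|H]; [exists (f (o, x)); auto|].
        exists (f (i, proj1_sig (g (exist _ x H)))). right. exists H. auto. }
      assert (phiA : forall x, A (phi x)).
      { intros x. destruct (Hphi x) as [[H ->]|[H ->]]; apply fA; auto;
          try apply Anu; apply proj2_sig. }
      assert (phiinj : forall x y, phi x = phi y -> x = y).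
      { intros x y E.
        destruct (Hphi x) as [[H1 E1]|[H1 E1]], (Hphi y) as [[H2 E2]|[H2 E2]];
          rewrite E1, E2 in E; apply finj in E; auto; try apply Anu; try apply proj2_sig;
          destruct E as [E E']; try congruence.
        apply proj1_sig_inj, Hg in E'.
        injection E'; auto. }
      exists (fun p => f (phi (fst p), phi (snd p))).
      intros [a b] [a' b'] E. apply finj in E; auto. destruct E. f_equal; auto.
Qed.

Lemma injects_list (T : Type) : injects nat T -> injects (list T) T.
Proof.
  intros HT. destruct (injects_square HT) as [h Hh]. destruct HT as [nu Hnu].
  set (code := fold_right (fun x c => h (x, c)) (nu 0%nat)).
  (* The length is recorded because [nu 0], the code of the empty list, may also be a value of
     [h]. *)
  exists (fun l => h (nu (length l), code l)).
  intros l l' E. apply Hh in E. injection E as E1 E2. apply Hnu in E1.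
  revert l' E1 E2. induction l as [|x l IH]; intros [|x' l'] E1 E2; try discriminate; auto.
  simpl in E1, E2. apply Hh in E2. injection E2 as -> E2. f_equal. apply IH; auto.
Qed.

Lemma injects_map_list (U V : Type) : injects U V -> injects (list U) (list V).
Proof. intros [f Hf]. exists (map f). intros l l'.
  revert l'. induction l as [|x l IH]; intros [|x' l'] E; try discriminate; auto.
  injection E as E1 E2. f_equal; auto.
Qed.

(** * Scalars *)

Lemma K_ring_theory (k : Kind) :
  ring_theory (Kzero k) (Kone k) (Kadd k) (Kmul k)
    (fun x y => Kadd k x (Kopp k y)) (Kopp k) eq.
Proof.
  split; destruct k; simpl; first [csolve|intros; ring].
Qed.

Definition Kreal (k : Kind) (r : R) : Kt k :=
  match k return Kt k with KReal => r | KComplex => mkC r 0 end.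

Lemma Kreal_0 (k : Kind) : Kreal k 0 = Kzero k.
Proof. destruct k; reflexivity. Qed.

Lemma Kreal_1 (k : Kind) : Kreal k 1 = Kone k.
Proof. destruct k; reflexivity. Qed.

Lemma Kreal_mult (k : Kind) (r s : R) : Kreal k (r * s) = Kmul k (Kreal k r) (Kreal k s).
Proof. destruct k; simpl; [ring|csolve]. Qed.

Lemma Kreal_plus (k : Kind) (r s : R) : Kreal k (r + s) = Kadd k (Kreal k r) (Kreal k s).
Proof. destruct k; simpl; [ring|csolve]. Qed.

Lemma Kreal_opp (k : Kind) (r : R) : Kreal k (- r) = Kopp k (Kreal k r).
Proof. destruct k; simpl; [ring|csolve]. Qed.

Lemma Kabs_Kreal (k : Kind) (r : R) : Kabs k (Kreal k r) = Rabs r.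
Proof.
  destruct k; simpl; [reflexivity|]. unfold Cmod; simpl.
  replace (r * r + 0 * 0) with (Rsqr r) by (unfold Rsqr; ring). apply sqrt_Rsqr_abs.
Qed.

Lemma Kreal_inj (k : Kind) (r s : R) : Kreal k r = Kreal k s -> r = s.
Proof. destruct k; simpl; [auto|]. intro H; injection H; auto. Qed.

Lemma Kabs_nonneg (k : Kind) (c : Kt k) : 0 <= Kabs k c.
Proof. destruct k; simpl; [apply Rabs_pos|apply Cmod_ge0]. Qed.

Lemma Kabs_0 (k : Kind) : Kabs k (Kzero k) = 0.
Proof. rewrite <- Kreal_0, Kabs_Kreal. apply Rabs_R0. Qed.

Lemma Kabs_1 (k : Kind) : Kabs k (Kone k) = 1.
Proof. rewrite <- Kreal_1, Kabs_Kreal. apply Rabs_R1. Qed.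

Lemma K_inverse (k : Kind) (c : Kt k) : c <> Kzero k -> exists d, Kmul k d c = Kone k.
Proof.
  destruct k; simpl; intro Hc.
  - exists (/ c). field. exact Hc.
  - assert (H : Cre c * Cre c + Cim c * Cim c <> 0).
    { intro E. apply Hc. apply Cext; simpl; nra. }
    exists (mkC (Cre c / (Cre c * Cre c + Cim c * Cim c))
                (- Cim c / (Cre c * Cre c + Cim c * Cim c))).
    apply Cext; simpl; field; exact H.
Qed.

Lemma K_injects_square (k : Kind) : injects (Kt k) (R * R).
Proof.
  destruct k; simpl.
  - exists (fun r => (r, r)). intros r s E. injection E; auto.
  - exists (fun z => (Cre z, Cim z)). intros [a b] [c d] E. injection E as -> ->; auto.
Qed.

(** * Linear algebra in a Banach space *)

Section Reflection.
Variables (k : Kind) (X : Banach k).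
Add Ring Kring : (K_ring_theory k).

Lemma bscal_zero_l (x : X) : bscal X (Kzero k) x = bzero X.
Proof.
  assert (E : badd X (bscal X (Kzero k) x) (bscal X (Kzero k) x) = bscal X (Kzero k) x).
  { rewrite <- bscal_distr_k. f_equal. ring. }
  rewrite <- (badd_opp X (bscal X (Kzero k) x)). rewrite <- E at 2.
  rewrite <- badd_assoc, badd_opp, badd_0. reflexivity.
Qed.

Lemma bopp_scal (x : X) : bopp X x = bscal X (Kopp k (Kone k)) x.
Proof.
  assert (E : badd X x (bscal X (Kopp k (Kone k)) x) = bzero X).
  { rewrite <- (bscal_1 X x) at 1. rewrite <- bscal_distr_k, <- (bscal_zero_l x).
    f_equal. ring. }
  rewrite <- (badd_0 X (bopp X x)), <- E, badd_assoc, (badd_comm X (bopp X x)).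
  rewrite badd_opp, badd_comm, badd_0. reflexivity.
Qed.

Lemma bscal_zero_r (c : Kt k) : bscal X c (bzero X) = bzero X.
Proof.
  rewrite <- (bscal_zero_l (bzero X)), bscal_assoc. f_equal. ring.
Qed.

(** Syntax for a proof by reflection: both sides of an identity are read as expressions over one
    list of atoms, and the identity follows once the coefficients at every atom agree. *)
Inductive vexpr :=
  | VVar (n : nat) | VZero | VAdd (e f : vexpr) | VOpp (e : vexpr)
  | VScal (c : Kt k) (e : vexpr).

Fixpoint vdenote (env : list X) (e : vexpr) : X :=
  match e with
  | VVar n => nth n env (bzero X)
  | VZero => bzero X
  | VAdd e f => badd X (vdenote env e) (vdenote env f)
  | VOpp e => bopp X (vdenote env e)
  | VScal c e => bscal X c (vdenote env e)
  end.

Fixpoint vcoef (e : vexpr) (i : nat) : Kt k :=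
  match e with
  | VVar n => if Nat.eqb i n then Kone k else Kzero k
  | VZero => Kzero k
  | VAdd e f => Kadd k (vcoef e i) (vcoef f i)
  | VOpp e => Kopp k (vcoef e i)
  | VScal c e => Kmul k c (vcoef e i)
  end.

Fixpoint vnormal (env : list X) (f : nat -> Kt k) : X :=
  match env with
  | nil => bzero X
  | x :: env => badd X (bscal X (f 0%nat) x) (vnormal env (fun i => f (S i)))
  end.

(** An iterated conjunction rather than a bounded quantifier, so that for a concrete [n] it computes
    to one scalar equation per atom. *)
Fixpoint vagree (n : nat) (f g : nat -> Kt k) : Prop :=
  match n with
  | O => True
  | S n => f 0%nat = g 0%nat /\ vagree n (fun i => f (S i)) (fun i => g (S i))
  end.

Lemma badd_swap (x y z t : X) :
  badd X (badd X x y) (badd X z t) = badd X (badd X x z) (badd X y t).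
Proof.
  rewrite <- !badd_assoc. f_equal. rewrite !badd_assoc. f_equal. apply badd_comm.
Qed.

Lemma vnormal_add (env : list X) (f g : nat -> Kt k) :
  vnormal env (fun i => Kadd k (f i) (g i)) = badd X (vnormal env f) (vnormal env g).
Proof.
  revert f g. induction env as [|x env IH]; intros f g; simpl.
  - rewrite badd_0. reflexivity.
  - rewrite IH, bscal_distr_k. apply badd_swap.
Qed.

Lemma vnormal_scal (env : list X) (c : Kt k) (f : nat -> Kt k) :
  vnormal env (fun i => Kmul k c (f i)) = bscal X c (vnormal env f).
Proof.
  revert f. induction env as [|x env IH]; intros f; simpl.
  - rewrite bscal_zero_r. reflexivity.
  - rewrite IH, bscal_distr_v, bscal_assoc. reflexivity.
Qed.

Lemma vnormal_zero (env : list X) : vnormal env (fun _ => Kzero k) = bzero X.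
Proof.
  induction env as [|x env IH]; simpl; [reflexivity|].
  rewrite IH, bscal_zero_l, badd_0. reflexivity.
Qed.

Lemma vdenote_normal (env : list X) (e : vexpr) : vdenote env e = vnormal env (vcoef e).
Proof.
  induction e as [n| |e IHe f IHf|e IHe|c e IHe]; simpl.
  - revert n. induction env as [|x env IH]; intros [|n]; simpl; auto.
    + change (x = badd X (bscal X (Kone k) x) (vnormal env (fun _ => Kzero k))).
      rewrite vnormal_zero, bscal_1, badd_0. reflexivity.
    + rewrite IH, bscal_zero_l, badd_comm, badd_0. reflexivity.
  - symmetry. apply vnormal_zero.
  - rewrite IHe, IHf. symmetry. apply vnormal_add.
  - rewrite IHe, bopp_scal, <- vnormal_scal. f_equal.
    apply functional_extensionality; intro i. ring.
  - rewrite IHe. symmetry. apply vnormal_scal.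
Qed.

Lemma vnormal_ext (env : list X) (f g : nat -> Kt k) :
  vagree (length env) f g -> vnormal env f = vnormal env g.
Proof.
  revert f g. induction env as [|x env IH]; intros f g H; simpl; [reflexivity|].
  destruct H as [H0 H]. rewrite H0, (IH _ _ H). reflexivity.
Qed.

Lemma vexpr_eq (env : list X) (e f : vexpr) :
  vagree (length env) (vcoef e) (vcoef f) -> vdenote env e = vdenote env f.
Proof. rewrite !vdenote_normal. apply vnormal_ext. Qed.

End Reflection.

Ltac vmem x env :=
  lazymatch env with
  | nil => constr:(false)
  | cons x _ => constr:(true)
  | cons _ ?t => vmem x t
  end.

Ltac vatoms X e env :=
  lazymatch e with
  | badd X ?a ?b => let env := vatoms X a env in vatoms X b env
  | bopp X ?a => vatoms X a env
  | bscal X _ ?a => vatoms X a env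
  | bzero X => env
  | _ => lazymatch vmem e env with true => env | false => constr:(cons e env) end
  end.

Ltac vindex x env :=
  lazymatch env with
  | cons x _ => constr:(O)
  | cons _ ?t => let n := vindex x t in constr:(S n)
  end.

Ltac vreify k X e env :=
  lazymatch e with
  | badd X ?a ?b =>
      let a := vreify k X a env in let b := vreify k X b env in constr:(@VAdd k a b)
  | bopp X ?a => let a := vreify k X a env in constr:(@VOpp k a)
  | bscal X ?c ?a => let a := vreify k X a env in constr:(@VScal k c a)
  | bzero X => constr:(@VZero k)
  | _ => let n := vindex e env in constr:(@VVar k n)
  end.

(* Reduces an identity between linear combinations of vectors to the identities
   between the coefficients of each atom. *)
Ltac vcoefs :=
  lazymatch goal with
  | |- @eq (@bcar ?k ?X) ?a ?b =>
      let env := vatoms X a (@nil (@bcar k X)) in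
      let env := vatoms X b env in
      let ea := vreify k X a env in
      let eb := vreify k X b env in
      change (vdenote X env ea = vdenote X env eb);
      apply vexpr_eq; cbn [length vagree vcoef Nat.eqb]; repeat split
  end.

(** * Norm estimates and series dominated by a geometric one *)

Section Norm.
Variables (k : Kind) (X : Banach k).
Add Ring Kring2 : (K_ring_theory k).

Definition vsub (x y : X) : X := badd X x (bopp X y).

Lemma vsub_eq0 (x y : X) : vsub x y = bzero X -> x = y.
Proof.
  intro H. rewrite <- (badd_0 X y), <- H. unfold vsub. vcoefs; ring.
Qed.

Lemma bnorm_0 : bnorm X (bzero X) = 0.
Proof. rewrite <- (bscal_zero_l X (bzero X)), bnorm_scal, Kabs_0. ring. Qed.

Lemma bnorm_opp (x : X) : bnorm X (bopp X x) = bnorm X x.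
Proof.
  rewrite bopp_scal, bnorm_scal, <- Kreal_1, <- Kreal_opp, Kabs_Kreal.
  rewrite Rabs_Ropp, Rabs_R1. ring.
Qed.

Lemma bnorm_nonneg (x : X) : 0 <= bnorm X x.
Proof.
  pose proof (bnorm_triangle X x (bopp X x)) as H.
  rewrite badd_opp, bnorm_0, bnorm_opp in H. lra.
Qed.

Lemma bnorm_pos (x : X) : x <> bzero X -> 0 < bnorm X x.
Proof.
  intro H. destruct (bnorm_nonneg x) as [H'|H']; [exact H'|].
  exfalso; apply H, bnorm_eq0; auto.
Qed.

Lemma bnorm_sub_sym (x y : X) : bnorm X (vsub x y) = bnorm X (vsub y x).
Proof. rewrite <- bnorm_opp. f_equal. unfold vsub. vcoefs; ring. Qed.

Lemma bnorm_sub_triangle (x y z : X) :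
  bnorm X (vsub x z) <= bnorm X (vsub x y) + bnorm X (vsub y z).
Proof.
  replace (vsub x z) with (badd X (vsub x y) (vsub y z)); [apply bnorm_triangle|].
  unfold vsub. vcoefs; ring.
Qed.

Lemma bnorm_small_eq (x y : X) :
  (forall eps, 0 < eps -> bnorm X (vsub x y) <= eps) -> x = y.
Proof.
  intro H. apply vsub_eq0. apply NNPP; intro Hn. apply bnorm_pos in Hn.
  specialize (H (bnorm X (vsub x y) / 2) ltac:(lra)). lra.
Qed.

Lemma bscal_cancel (c : Kt k) (x : X) :
  c <> Kzero k -> bscal X c x = bzero X -> x = bzero X.
Proof.
  intros Hc E. destruct (K_inverse k Hc) as [d Hd].
  rewrite <- (bscal_1 X x), <- Hd, <- bscal_assoc, E. apply bscal_zero_r.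
Qed.

Fixpoint psum (u : nat -> X) (n : nat) : X :=
  match n with O => bzero X | S n => badd X (psum u n) (u n) end.

Lemma eighth_decay_vanishes (rho : nat -> R) :
  (forall n, 0 <= rho n) -> (forall n, rho (S n) <= rho n / 8) ->
  forall eps, 0 < eps -> exists N, forall n, (N <= n)%nat -> rho n < eps.
Proof.
  intros Hpos Hdec eps He.
  assert (H : forall n, rho n <= rho 0%nat * (/ 8) ^ n).
  { induction n as [|n IH]; simpl; [lra|]. specialize (Hdec n). lra. }
  (* The denominator is [rho 0 + 1] because [rho 0] may vanish. *)
  destruct (pow_lt_1_zero (/ 8) ltac:(rewrite Rabs_pos_eq; lra) (eps / (rho 0%nat + 1)))
    as [N HN].
  { apply Rdiv_lt_0_compat; [exact He|]. specialize (Hpos 0%nat). lra. }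
  exists N. intros n Hn. specialize (HN n Hn). specialize (H n).
  assert (H8 : 0 < (/ 8) ^ n) by (apply pow_lt; lra).
  rewrite Rabs_pos_eq in HN by lra.
  pose proof (Hpos 0%nat) as H0.
  apply (Rmult_lt_compat_r (rho 0%nat + 1)) in HN; [|lra].
  replace (eps / (rho 0%nat + 1) * (rho 0%nat + 1)) with eps in HN by (field; lra).
  nra.
Qed.

Lemma psum_increment (u : nat -> X) (rho : nat -> R) :
  (forall n, rho (S n) <= rho n / 8) -> (forall n, bnorm X (u n) <= rho n) ->
  forall n m, bnorm X (vsub (psum u (m + n)) (psum u n)) <= 8 / 7 * rho n.
Proof.
  intros Hdec Hu n m.
  (* This sharper bound telescopes: [rho (S n) <= rho n / 8] gives
     [rho n <= 8/7 * (rho n - rho (S n))]. *)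
  enough (bnorm X (vsub (psum u (m + n)) (psum u n)) <= 8 / 7 * (rho n - rho (m + n)%nat)).
  { pose proof (bnorm_nonneg (u (m + n)%nat)). specialize (Hu (m + n)%nat). lra. }
  induction m as [|m IH]; simpl.
  - unfold vsub. rewrite badd_opp, bnorm_0. lra.
  - replace (vsub _ _) with (badd X (vsub (psum u (m + n)) (psum u n)) (u (m + n)%nat))
      by (unfold vsub; vcoefs; ring).
    eapply Rle_trans; [apply bnorm_triangle|].
    specialize (Hu (m + n)%nat). specialize (Hdec (m + n)%nat). lra.
Qed.

Lemma series_converges (u : nat -> X) (rho : nat -> R) :
  (forall n, rho (S n) <= rho n / 8) -> (forall n, bnorm X (u n) <= rho n) ->
  exists l, forall n, bnorm X (vsub l (psum u n)) <= 8 / 7 * rho n.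
Proof.
  intros Hdec Hu.
  assert (Hpos : forall n, 0 <= rho n).
  { intro n. pose proof (bnorm_nonneg (u n)). specialize (Hu n). lra. }
  assert (Htail : forall n m, (n <= m)%nat ->
    bnorm X (vsub (psum u m) (psum u n)) <= 8 / 7 * rho n).
  { intros n m Hnm. replace m with (m - n + n)%nat by lia. apply psum_increment; auto. }
  destruct (bcomplete X (psum u)) as [l Hl].
  - intros eps He.
    destruct (eighth_decay_vanishes rho Hpos Hdec (eps := eps / 4) ltac:(lra))
      as [N HN].
    exists N. intros m n Hm Hn.
    eapply Rle_lt_trans; [apply (bnorm_sub_triangle (psum u m) (psum u N) (psum u n))|].
    rewrite (bnorm_sub_sym (psum u N)).
    pose proof (Htail N m Hm). pose proof (Htail N n Hn). specialize (HN N ltac:(lia)). lra.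
  - exists l. intro n. apply Rnot_lt_le. intro H.
    (* If the tail bound failed by some excess, a later partial sum closer to [l] than this excess
       would break the bound on finite tails. *)
    destruct (Hl (bnorm X (vsub l (psum u n)) - 8 / 7 * rho n)) as [N HN]; [lra|].
    specialize (HN (N + n)%nat ltac:(lia)). fold (vsub (psum u (N + n)) l) in HN.
    pose proof (bnorm_sub_triangle l (psum u (N + n)) (psum u n)) as Ht.
    rewrite (bnorm_sub_sym l (psum u (N + n))) in Ht.
    specialize (Htail n (N + n)%nat ltac:(lia)). lra.
Qed.

End Norm.

(** * The cardinality of a Banach space *)

Section SequencesInject.
Variables (k : Kind) (X : Banach k).
Add Ring Kring3 : (K_ring_theory k).

Lemma pow2_bounded_eq0 (d C : R) : 0 <= d -> (forall n, 2 ^ n * d <= C) -> d = 0.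
Proof.
  intros Hd H. destruct Hd as [Hd|Hd]; [exfalso|auto].
  destruct (Pow_x_infinity 2 ltac:(rewrite Rabs_pos_eq; lra) (C / d + 1)) as [N HN].
  specialize (HN N ltac:(lia)). specialize (H N).
  rewrite Rabs_pos_eq in HN by (apply pow_le; lra).
  apply Rge_le, (Rmult_le_compat_r d) in HN; [|lra].
  replace ((C / d + 1) * d) with (C + d) in HN by (field; lra). lra.
Qed.

(** A vector of the ball at distance at least 1/2 from all of a maximal [S] could be added to [S],
    hence would belong to [S], although its distance to itself is 0. *)
Lemma maximal_separated_subset :
  exists S : X -> Prop,
    (forall s, S s -> bnorm X s <= 1) /\
    (forall s t, S s -> S t -> s <> t -> / 2 <= bnorm X (vsub X s t)) /\
    (forall x, bnorm X x <= 1 -> exists s, S s /\ bnorm X (vsub X x s) < / 2).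
Proof.
  destruct (@zorn_subsets_above X (fun S => (forall s, S s -> bnorm X s <= 1) /\
    (forall s t, S s -> S t -> s <> t -> / 2 <= bnorm X (vsub X s t))) (fun _ => False))
    as [S [[S1 S2] [_ Smax]]].
  - split; contradiction.
  - intros C _ CP Ctot. split.
    + intros s [A [CA HA]]. apply (proj1 (CP A CA)); auto.
    + intros s t [A [CA HA]] [B [CB HB]].
      destruct (Ctot A B CA CB) as [H|H];
        [apply (proj2 (CP B CB))|apply (proj2 (CP A CA))]; auto.
  - exists S. split; [exact S1|]. split; [exact S2|].
    intros x Hx. apply NNPP; intro Hn.
    assert (Hfar : forall s, S s -> / 2 <= bnorm X (vsub X x s)).
    { intros s Hs. apply Rnot_lt_le; intro H. apply Hn; eauto. }
    assert (HSx : S x).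
    { apply (Smax (fun y => S y \/ y = x)); [split|auto|auto].
      - intros s [Hs| ->]; auto.
      - intros s t [Hs| ->] [Ht| ->] Hst; auto; [|congruence].
        rewrite bnorm_sub_sym; auto. }
    specialize (Hfar x HSx). unfold vsub in Hfar. rewrite badd_opp, bnorm_0 in Hfar. lra.
Qed.

(** An injection of [X] into its unit ball: the norm [r] becomes [r / (1 + r)], which determines [r]
    and hence the scaling factor. *)
Definition shrink (x : X) : X := bscal X (Kreal k (/ (1 + bnorm X x))) x.

Lemma bnorm_shrink (x : X) : bnorm X (shrink x) = bnorm X x / (1 + bnorm X x).
Proof.
  pose proof (bnorm_nonneg X x). unfold shrink. rewrite bnorm_scal, Kabs_Kreal.
  rewrite Rabs_pos_eq by (left; apply Rinv_0_lt_compat; lra). field. lra.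
Qed.

Lemma bnorm_shrink_le (x : X) : bnorm X (shrink x) <= 1.
Proof.
  pose proof (bnorm_nonneg X x). rewrite bnorm_shrink.
  apply Rmult_le_reg_r with (1 + bnorm X x); [lra|]. field_simplify; lra.
Qed.

Lemma shrink_inj : Injective shrink.
Proof.
  intros x y E. pose proof (bnorm_nonneg X x) as Hx. pose proof (bnorm_nonneg X y) as Hy.
  assert (En : bnorm X x = bnorm X y).
  { apply (f_equal (bnorm X)) in E. rewrite !bnorm_shrink in E.
    apply (f_equal (fun r => r * ((1 + bnorm X x) * (1 + bnorm X y)))) in E.
    field_simplify in E; lra. }
  unfold shrink in E. rewrite En in E.
  apply (f_equal (bscal X (Kreal k (1 + bnorm X y)))) in E.
  rewrite !bscal_assoc, <- Kreal_mult, Rinv_r, Kreal_1, !bscal_1 in E by lra.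
  exact E.
Qed.

Section Coding.
Variables (S : X -> Prop) (near : X -> sig S).
Hypothesis near_spec : forall x, bnorm X x <= 1 -> bnorm X (vsub X x (proj1_sig (near x))) < / 2.

(** Remainders of a binary expansion with digits in [S]: subtracting the nearby digit leaves norm
    below 1/2, and doubling returns to the unit ball. *)
Fixpoint orbit (x : X) (n : nat) : X :=
  match n with
  | O => x
  | Datatypes.S n =>
      bscal X (Kreal k 2) (vsub X (orbit x n) (proj1_sig (near (orbit x n))))
  end.

Lemma bnorm_orbit (x : X) (n : nat) : bnorm X x <= 1 -> bnorm X (orbit x n) <= 1.
Proof.
  intro Hx. induction n as [|n IH]; simpl; [exact Hx|].
  rewrite bnorm_scal, Kabs_Kreal, Rabs_pos_eq by lra. specialize (near_spec _ IH). lra.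
Qed.

(* If [x] and [y] have the same digits, then [orbit x n - orbit y n = 2^n (x - y)]
   stays bounded. *)
Lemma digits_inj (x y : X) :
  bnorm X x <= 1 -> bnorm X y <= 1 ->
  (forall n, near (orbit x n) = near (orbit y n)) -> x = y.
Proof.
  intros Hx Hy E.
  assert (H : forall n, vsub X (orbit x n) (orbit y n) = bscal X (Kreal k (2 ^ n)) (vsub X x y)).
  { induction n as [|n IH]; simpl.
    - rewrite Kreal_1, bscal_1. reflexivity.
    - rewrite Kreal_mult, <- bscal_assoc, <- IH, E. unfold vsub. vcoefs; ring. }
  apply vsub_eq0, bnorm_eq0, pow2_bounded_eq0 with 2; [apply bnorm_nonneg|].
  intro n. specialize (H n). apply (f_equal (bnorm X)) in H.
  rewrite bnorm_scal, Kabs_Kreal, Rabs_pos_eq in H by (apply pow_le; lra).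
  rewrite <- H. unfold vsub. eapply Rle_trans; [apply bnorm_triangle|].
  rewrite bnorm_opp. pose proof (bnorm_orbit x n Hx). pose proof (bnorm_orbit y n Hy). lra.
Qed.

End Coding.

Lemma psum_ext (u v : nat -> X) (n : nat) :
  (forall i, (i < n)%nat -> u i = v i) -> psum X u n = psum X v n.
Proof.
  induction n as [|n IH]; intro H; simpl; [reflexivity|].
  rewrite IH, H by auto. reflexivity.
Qed.

(** If [s] and [t] first differ at [n], the partial sums through [n] differ by at least [8^-n / 2],
    while the two tails together contribute at most [2 * 8/7 * 8^-(n+1) = 2/7 * 8^-n]. *)
Lemma injects_separated_sequences (S : X -> Prop) :
  (forall s, S s -> bnorm X s <= 1) ->
  (forall s t, S s -> S t -> s <> t -> / 2 <= bnorm X (vsub X s t)) ->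
  injects (nat -> sig S) X.
Proof.
  intros S1 S2.
  set (u := fun (s : nat -> sig S) n => bscal X (Kreal k ((/ 8) ^ n)) (proj1_sig (s n))).
  assert (H8 : forall n, 0 < (/ 8) ^ n) by (intro n; apply pow_lt; lra).
  destruct (functional_choice (fun s l => forall n,
    bnorm X (vsub X l (psum X (u s) n)) <= 8 / 7 * (/ 8) ^ n)) as [f Hf].
  { intro s. apply series_converges.
    - intro n; simpl; lra.
    - intro n. unfold u. rewrite bnorm_scal, Kabs_Kreal.
      rewrite Rabs_pos_eq by (left; auto).
      pose proof (S1 _ (proj2_sig (s n))). specialize (H8 n). nra. }
  exists f. intros s t E. apply functional_extensionality. intro n.
  induction n as [n IH] using Wf_nat.lt_wf_ind.
  apply proj1_sig_inj, NNPP. intro Hn.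
  apply S2 in Hn; [|apply proj2_sig|apply proj2_sig].
  assert (Ep : psum X (u s) n = psum X (u t) n).
  { apply psum_ext. intros i Hi. unfold u. rewrite IH by exact Hi. reflexivity. }
  pose proof (Hf s (Datatypes.S n)) as Hs. pose proof (Hf t (Datatypes.S n)) as Ht.
  rewrite <- E in Ht. rewrite bnorm_sub_sym in Hs.
  pose proof (bnorm_sub_triangle X (psum X (u s) (Datatypes.S n)) (f s)
    (psum X (u t) (Datatypes.S n))) as H.
  assert (Ed : bnorm X (vsub X (psum X (u s) (Datatypes.S n)) (psum X (u t) (Datatypes.S n)))
    = (/ 8) ^ n * bnorm X (vsub X (proj1_sig (s n)) (proj1_sig (t n)))).
  { rewrite <- (Rabs_pos_eq ((/ 8) ^ n)) by (left; auto).
    rewrite <- (Kabs_Kreal k), <- bnorm_scal. f_equal. simpl. rewrite Ep.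
    unfold vsub, u. vcoefs; ring. }
  rewrite Ed in H. rewrite <- tech_pow_Rmult in Hs, Ht. specialize (H8 n). nra.
Qed.

(* With [S] maximal 1/2-separated in the unit ball, [X] injects into [S^N] by iterated
   approximation, and [S^N] into [X] by [s |-> sum_n 8^-n s_n]. *)
Lemma injects_sequences_self : injects (nat -> X) X.
Proof.
  destruct maximal_separated_subset as [S [S1 [S2 S3]]].
  assert (H : injects X (nat -> sig S)).
  { destruct (functional_choice (fun x (s : sig S) => bnorm X x <= 1 ->
      bnorm X (vsub X x (proj1_sig s)) < / 2)) as [near Hnear].
    (* [S] is nonempty since it has a point near 0; [s0] serves as default digit outside the unit
       ball. *)
    { intro x. destruct (S3 (bzero X)) as [s0 [Hs0 _]]; [rewrite bnorm_0; lra|].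
      destruct (Rle_dec (bnorm X x) 1) as [Hx|Hx].
      - destruct (S3 x Hx) as [s [Hs Hxs]]. exists (exist _ s Hs). auto.
      - exists (exist _ s0 Hs0). contradiction. }
    exists (fun x n => near (orbit near (shrink x) n)). intros x y E.
    apply shrink_inj. apply (digits_inj near Hnear); try apply bnorm_shrink_le.
    exact (equal_f E). }
  eapply injects_trans; [exact (injects_sequences H)|].
  eapply injects_trans; [apply sequences_of_sequences_injects|].
  apply injects_separated_sequences; assumption.
Qed.

End SequencesInject.

(** * A linearly independent family indexed by the reals *)

Section IndependentFamily.
Variables (k : Kind) (X : Banach k).
Add Ring Kring4 : (K_ring_theory k).

(** The span is defined by recursion on the generators, so that its closedness can be proved by
    adding one vector at a time. *)
Fixpoint inspan (l : list X) (x : X) : Prop :=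
  match l with
  | nil => x = bzero X
  | v :: l => exists c y, inspan l y /\ x = badd X (bscal X c v) y
  end.

Lemma inspan_0 (l : list X) : inspan l (bzero X).
Proof.
  induction l as [|v l IH]; simpl; [reflexivity|].
  exists (Kzero k), (bzero X). split; [exact IH|]. vcoefs; ring.
Qed.

Lemma inspan_add (l : list X) (x y : X) : inspan l x -> inspan l y -> inspan l (badd X x y).
Proof.
  revert x y. induction l as [|v l IH]; simpl; intros x y.
  - intros -> ->. apply badd_0.
  - intros [c [x' [Hx ->]]] [d [y' [Hy ->]]].
    exists (Kadd k c d), (badd X x' y'). split; [auto|]. vcoefs; ring.
Qed.

Lemma inspan_scal (l : list X) (a : Kt k) (x : X) : inspan l x -> inspan l (bscal X a x).
Proof.
  revert x. induction l as [|v l IH]; simpl; intros x.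
  - intros ->. apply bscal_zero_r.
  - intros [c [x' [Hx ->]]]. exists (Kmul k a c), (bscal X a x'). split; [auto|]. vcoefs; ring.
Qed.

Lemma inspan_cons (l : list X) (v x : X) : inspan l x -> inspan (v :: l) x.
Proof.
  intro H. exists (Kzero k), x. split; [exact H|]. vcoefs; ring.
Qed.

Lemma infinite_dim_not_inspan (l : list X) : infinite_dim X -> exists x, ~ inspan l x.
Proof.
  intros H. apply NNPP; intro Hn. apply H. exists l. intro x.
  assert (Hx : inspan l x) by (apply NNPP; intro; apply Hn; eauto).
  clear H Hn. revert x Hx. induction l as [|v l IH]; simpl; intros x Hx.
  - exists nil. simpl. auto.
  - destruct Hx as [c [y [Hy ->]]]. destruct (IH y Hy) as [cl [H ->]].
    exists ((c, v) :: cl). simpl. split; [|reflexivity].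
    intros w [Hw|Hw]; auto.
Qed.

(** Finite dimensional subspaces are closed. For a new generator [x] outside the span of [l],
    suppose that [c n * x + w n] tends to [y]. The distance from [x] to the span of [l] makes [c n]
    Cauchy; with its limit [c0], the [w n] approach [y - c0 * x], which by induction is at positive
    distance from the span of [l]. *)
Lemma inspan_dist (l : list X) (y : X) :
  ~ inspan l y -> exists delta, 0 < delta /\
    forall v, inspan l v -> delta <= bnorm X (vsub X y v).
Proof.
  revert y. induction l as [|x l IH]; intros y Hy.
  - exists (bnorm X y). split; [apply bnorm_pos; exact Hy|].
    intros v Hv. simpl in Hv. subst v. right. f_equal. unfold vsub. vcoefs; ring.
  - destruct (classic (inspan l x)) as [Hx|Hx].
    + destruct (IH y) as [delta [Hd H]].
      { intro H; apply Hy, inspan_cons, H. }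
      exists delta. split; [exact Hd|]. intros v [c [w [Hw ->]]].
      apply H, inspan_add; [apply inspan_scal|]; assumption.
    + destruct (IH x Hx) as [delta [Hd Hdist]].
      apply NNPP; intro Hn.
      assert (Happ : forall n : nat, exists cw : Kt k * X, inspan l (snd cw) /\
        bnorm X (vsub X y (badd X (bscal X (fst cw) x) (snd cw))) < / INR (S n)).
      { intro n. apply NNPP; intro Hm. apply Hn. exists (/ INR (S n)). split.
        { apply Rinv_0_lt_compat, lt_0_INR; lia. }
        intros v [c [w [Hw ->]]]. apply Rnot_lt_le; intro H.
        apply Hm. exists (c, w). auto. }
      destruct (functional_choice _ Happ) as [cw Hcw]. clear Happ Hn.
      set (c := fun n => fst (cw n)). set (w := fun n => snd (cw n)).
      assert (Hsmall : forall eps, 0 < eps -> exists N, forall n, (N <= n)%nat ->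
        bnorm X (vsub X y (badd X (bscal X (c n) x) (w n))) < eps).
      { intros eps He. destruct (archimed_cor1 eps He) as [N [HN HN0]].
        exists N. intros n Hn. eapply Rlt_trans; [apply Hcw|].
        eapply Rle_lt_trans; [|exact HN]. apply Rinv_le_contravar.
        - apply lt_0_INR; lia.
        - apply le_INR; lia. }
      assert (Hc : forall a v, inspan l v -> Kabs k a * delta <=
        bnorm X (vsub X (bscal X a x) v)).
      { intros a v Hv. destruct (classic (a = Kzero k)) as [->|Ha].
        - rewrite Kabs_0, Rmult_0_l. apply bnorm_nonneg.
        - destruct (K_inverse k Ha) as [b Hb].
          replace (vsub X (bscal X a x) v) with (bscal X a (vsub X x (bscal X b v))).
          + rewrite bnorm_scal. apply Rmult_le_compat_l; [apply Kabs_nonneg|].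
            apply Hdist, inspan_scal, Hv.
          + unfold vsub.
            replace (bscal X a (badd X x (bopp X (bscal X b v)))) with
              (badd X (bscal X a x) (bopp X (bscal X (Kmul k b a) v)))
              by (vcoefs; ring).
            rewrite Hb, bscal_1. reflexivity. }
      assert (Hspan : forall n, inspan l (w n)) by (intro n; apply Hcw).
      destruct (Kb_complete k c) as [c0 Hc0].
      { intros eps He. destruct (Hsmall (eps * delta / 2)) as [N HN]; [nra|].
        exists N. intros m n Hm Hn.
        apply Rmult_lt_reg_r with delta; [exact Hd|].
        (* [(c m - c n) * x - (w n - w m)] is the difference of the approximants of index [m] and
           [n], both close to [y]. *)
        eapply Rle_lt_trans; [apply (Hc _ (vsub X (w n) (w m)))|].
        { apply inspan_add; [auto|]. rewrite bopp_scal. apply inspan_scal; auto. }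
        set (p := fun n => badd X (bscal X (c n) x) (w n)).
        replace (vsub X _ _) with (vsub X (p m) (p n)) by (unfold p, vsub; vcoefs; ring).
        eapply Rle_lt_trans; [apply (bnorm_sub_triangle X (p m) y)|].
        rewrite (bnorm_sub_sym X (p m)).
        pose proof (HN m Hm). pose proof (HN n Hn). unfold p. lra. }
      destruct (IH (vsub X y (bscal X c0 x))) as [d' [Hd' H']].
      { intro H. apply Hy. exists c0, (vsub X y (bscal X c0 x)). split; [exact H|].
        unfold vsub. vcoefs; ring. }
      assert (Hxpos : 0 < bnorm X x).
      { apply bnorm_pos. intros ->. apply Hx, inspan_0. }
      destruct (Hsmall (d' / 2)) as [N1 HN1]; [lra|].
      destruct (Hc0 (d' / 2 / bnorm X x)) as [N2 HN2].
      { apply Rdiv_lt_0_compat; lra. }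
      specialize (HN1 (Nat.max N1 N2) ltac:(lia)). specialize (HN2 (Nat.max N1 N2) ltac:(lia)).
      set (n := Nat.max N1 N2) in *.
      specialize (H' (w n) (Hspan n)).
      apply (Rmult_lt_compat_r (bnorm X x)) in HN2; [|exact Hxpos].
      replace (d' / 2 / bnorm X x * bnorm X x) with (d' / 2) in HN2 by (field; lra).
      rewrite <- bnorm_scal in HN2.
      pose proof (bnorm_triangle X (vsub X y (badd X (bscal X (c n) x) (w n)))
        (bscal X (Kadd k (c n) (Kopp k c0)) x)) as Ht.
      replace (badd X (vsub X y (badd X (bscal X (c n) x) (w n)))
        (bscal X (Kadd k (c n) (Kopp k c0)) x)) with
        (vsub X (vsub X y (bscal X c0 x)) (w n)) in Ht by (unfold vsub; vcoefs; ring).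
      lra.
Qed.

Lemma exists_small_far_vector (l : list X) (rho : R) :
  infinite_dim X -> 0 < rho ->
  exists z delta, bnorm X z <= rho /\ 0 < delta /\
    forall v, inspan l v -> delta <= bnorm X (vsub X z v).
Proof.
  intros HX Hrho. destruct (infinite_dim_not_inspan l HX) as [x Hx].
  assert (Hxpos : 0 < bnorm X x).
  { apply bnorm_pos. intros ->. apply Hx, inspan_0. }
  assert (Hr : 0 < rho / bnorm X x) by (apply Rdiv_lt_0_compat; assumption).
  set (z := bscal X (Kreal k (rho / bnorm X x)) x).
  destruct (@inspan_dist l z) as [delta [Hd H]].
  { intro H. apply Hx.
    replace x with (bscal X (Kreal k (/ (rho / bnorm X x))) z); [apply inspan_scal, H|].
    unfold z. rewrite bscal_assoc, <- Kreal_mult, Rinv_l, Kreal_1 by lra. apply bscal_1. }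
  exists z, delta. split; [|auto].
  unfold z. rewrite bnorm_scal, Kabs_Kreal, Rabs_pos_eq by lra. right. field. lra.
Qed.

(* Each [z N] is at distance [delta N] from the span of its predecessors, and the later
   vectors are summably small compared with [delta N]. *)
Lemma exists_lacunary_sequence :
  infinite_dim X ->
  exists (z : nat -> X) (rho delta : nat -> R),
    (forall n, 0 < rho n) /\ (forall n, rho (S n) <= rho n / 8) /\
    (forall n, bnorm X (z n) <= rho n) /\
    (forall n, 0 < delta n) /\ (forall n, rho (S n) <= delta n / 8) /\
    (forall (b : nat -> Kt k) n,
       Kabs k (b n) * delta n <= bnorm X (psum X (fun i => bscal X (b i) (z i)) (S n))).
Proof.
  intro HX.
  destruct (functional_choice (fun (st : list X * R) (zd : X * R) => 0 < snd st ->
    bnorm X (fst zd) <= snd st /\ 0 < snd zd /\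
    forall v, inspan (fst st) v -> snd zd <= bnorm X (vsub X (fst zd) v))) as [ch Hch].
  { intros [l rho]. destruct (Rlt_dec 0 rho) as [H|H].
    - destruct (@exists_small_far_vector l rho HX H) as [z [d Hzd]]. exists (z, d). auto.
    - exists (bzero X, 0). intro; contradiction. }
  (* A state holds the vectors chosen so far and the norm bound for the next one. Taking the minimum
     with the new distance before dividing by 8 yields both decay conditions on [rho]. *)
  set (next := fun st : list X * R =>
    (fst (ch st) :: fst st, Rmin (snd st) (snd (ch st)) / 8)).
  set (st := fun n => Nat.iter n next (nil, 1)).
  assert (Hrho : forall n, 0 < snd (st n)).
  { induction n as [|n IH]; simpl; [lra|]. fold (st n). destruct (Hch _ IH) as [_ [H _]].
    unfold Rmin; destruct Rle_dec; lra. }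
  exists (fun n => fst (ch (st n))), (fun n => snd (st n)), (fun n => snd (ch (st n))).
  repeat split.
  - exact Hrho.
  - intro n. simpl. fold (st n). pose proof (Rmin_l (snd (st n)) (snd (ch (st n)))). lra.
  - intro n. apply (Hch _ (Hrho n)).
  - intro n. apply (Hch _ (Hrho n)).
  - intro n. simpl. fold (st n). pose proof (Rmin_r (snd (st n)) (snd (ch (st n)))). lra.
  - intros b n.
    assert (Hspan : inspan (fst (st n)) (psum X (fun i => bscal X (b i) (fst (ch (st i)))) n)).
    { induction n as [|n IH]; simpl; [reflexivity|]. fold (st n).
      exists (b n), (psum X (fun i => bscal X (b i) (fst (ch (st i)))) n).
      split; [exact IH|apply badd_comm]. }
    simpl. set (s := psum X _ n) in *. set (z := fst (ch (st n))).
    destruct (classic (b n = Kzero k)) as [Hb|Hb].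
    + rewrite Hb, Kabs_0, Rmult_0_l. apply bnorm_nonneg.
    + destruct (K_inverse k Hb) as [d Hd].
      (* Factoring out [b n] leaves the difference of [z] and a vector of the span of the earlier
         ones. *)
      replace (badd X s (bscal X (b n) z)) with
        (bscal X (b n) (vsub X z (bscal X (Kopp k d) s))).
      * rewrite bnorm_scal. apply Rmult_le_compat_l; [apply Kabs_nonneg|].
        apply (Hch _ (Hrho n)), inspan_scal, Hspan.
      * rewrite <- (bscal_1 X s) at 2. rewrite <- Hd. unfold vsub. vcoefs; ring.
Qed.

(** The coefficient of [z_n] in a linear combination of the vectors [y_t = sum_n t^n z_n]. *)
Fixpoint power_sum (l : list (Kt k * R)) (n : nat) : Kt k :=
  match l with
  | nil => Kzero k
  | (c, t) :: l => Kadd k (Kmul k c (Kreal k (t ^ n))) (power_sum l n)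
  end.

(** The l^1 norm of the coefficients; it bounds all power sums when the nodes lie in [[-1, 1]]. *)
Fixpoint coef_mass (l : list (Kt k * R)) : R :=
  match l with nil => 0 | (c, _) :: l => Kabs k c + coef_mass l end.

Lemma coef_mass_nonneg (l : list (Kt k * R)) : 0 <= coef_mass l.
Proof.
  induction l as [|[c t] l IH]; simpl; [lra|]. pose proof (Kabs_nonneg k c). lra.
Qed.

Lemma power_sum_bound (l : list (Kt k * R)) (n : nat) :
  (forall t, In t (map snd l) -> Rabs t <= 1) -> Kabs k (power_sum l n) <= coef_mass l.
Proof.
  induction l as [|[c t] l IH]; simpl; intro H; [rewrite Kabs_0; lra|].
  eapply Rle_trans; [apply Kb_triangle|]. rewrite Kb_norm_scal, Kabs_Kreal, <- RPow_abs.
  assert (Ht : Rabs t <= 1) by auto.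
  pose proof (pow_incr (Rabs t) 1 n (conj (Rabs_pos t) Ht)) as Hp.
  rewrite pow1 in Hp. pose proof (Kabs_nonneg k c). specialize (IH ltac:(auto)). nra.
Qed.

(* Vandermonde: [p (n+1) - t p n] is a power sum over the nodes other than [t]. *)
Lemma power_sum_eq0 (ts : list R) (l : list (Kt k * R)) :
  NoDup ts -> map snd l = ts -> (forall n, power_sum l n = Kzero k) ->
  forall c, In c (map fst l) -> c = Kzero k.
Proof.
  intro Hts. revert l. induction Hts as [|t ts Ht Hts IH]; intros l El Hl.
  - destruct l; [contradiction|discriminate].
  - destruct l as [|[c t'] l]; [discriminate|]. simpl in El. injection El as -> El.
    (* Multiplying the coefficient at each node [s] by [s - t] removes the node [t], so the
       induction hypothesis applies to the rest. *)
    set (g := fun ct : Kt k * R => (Kmul k (fst ct) (Kreal k (snd ct - t)), snd ct)).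
    assert (Hg : forall n, power_sum (map g l) n =
      Kadd k (power_sum l (S n)) (Kopp k (Kmul k (Kreal k t) (power_sum l n)))).
    { intro n. clear. induction l as [|[c s] l IH]; simpl; [ring|].
      rewrite IH. unfold Rminus. rewrite Kreal_plus, Kreal_opp, Kreal_mult. simpl. ring. }
    assert (Hrest : forall c', In c' (map fst l) -> c' = Kzero k).
    { intros c' Hc'. apply in_map_iff in Hc' as [[c'' s] [E Hs]]. simpl in E; subst c''.
      assert (H0 : Kmul k c' (Kreal k (s - t)) = Kzero k).
      { apply (IH (map g l)).
        - rewrite map_map. rewrite <- El. reflexivity.
        - intro n. rewrite Hg.
          pose proof (Hl n) as H1. pose proof (Hl (S n)) as H2. simpl in H1, H2.
          rewrite Kreal_mult in H2.
          transitivity (Kadd k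
            (Kadd k (Kmul k c (Kmul k (Kreal k t) (Kreal k (t ^ n)))) (power_sum l (S n)))
            (Kopp k (Kmul k (Kreal k t) (Kadd k (Kmul k c (Kreal k (t ^ n))) (power_sum l n))))).
          + ring.
          + rewrite H1, H2. ring.
        - rewrite map_map. apply in_map_iff. exists (c', s). auto. }
      assert (Hst : Kreal k (s - t) <> Kzero k).
      { rewrite <- Kreal_0. intro E. apply Kreal_inj in E. apply Ht.
        replace t with s by lra. rewrite <- El. apply in_map_iff. exists (c', s). auto. }
      destruct (K_inverse k Hst) as [d Hd].
      transitivity (Kmul k (Kmul k c' (Kreal k (s - t))) d).
      - transitivity (Kmul k c' (Kmul k d (Kreal k (s - t)))); [rewrite Hd; ring|ring].
      - rewrite H0. ring. }
    intros c' [Hc'|Hc']; [|auto]. simpl in Hc'. subst c'.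
    (* With the other coefficients zero, the power sum of exponent 0 isolates the one at [t], as
       [t^0 = 1] even for [t = 0]. *)
    assert (E0 : power_sum l 0 = Kzero k).
    { clear - Hrest. induction l as [|[c s] l IH]; simpl; [reflexivity|].
      rewrite IH by (intros; apply Hrest; right; auto).
      rewrite (Hrest c) by (left; reflexivity). ring. }
    specialize (Hl 0%nat). simpl in Hl. rewrite E0, Kreal_1 in Hl.
    rewrite <- Hl. ring.
Qed.

Definition family_comb (y : R -> X) (l : list (Kt k * R)) : X :=
  Xlincomb (map (fun ct => (fst ct, y (snd ct))) l).

Lemma exists_independent_family :
  infinite_dim X ->
  exists y : R -> X, forall l, NoDup (map snd l) -> family_comb y l = bzero X ->
    forall c, In c (map fst l) -> c = Kzero k.
Proof.
  intro HX.
  destruct (exists_lacunary_sequence HX)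
    as [z [rho [delta [Hrho [Hdec [Hz [Hdelta [Hrd Hcoef]]]]]]]].
  destruct (functional_choice (fun (t : R) (y : X) => Rabs t <= 1 -> forall n,
    bnorm X (vsub X y (psum X (fun i => bscal X (Kreal k (t ^ i)) (z i)) n)) <= 8 / 7 * rho n))
    as [y Hy].
  { intro t. destruct (Rle_dec (Rabs t) 1) as [Ht|Ht].
    - destruct (@series_converges k X (fun i => bscal X (Kreal k (t ^ i)) (z i)) rho)
        as [l Hl]; [exact Hdec| |exists l; auto].
      intro n. rewrite bnorm_scal, Kabs_Kreal, <- RPow_abs.
      pose proof (pow_incr (Rabs t) 1 n (conj (Rabs_pos t) Ht)) as Hp.
      rewrite pow1 in Hp. pose proof (bnorm_nonneg X (z n)). specialize (Hz n). nra.
    - exists (bzero X). contradiction. }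
  assert (Hunit : forall l, NoDup (map snd l) -> (forall t, In t (map snd l) -> Rabs t <= 1) ->
    family_comb y l = bzero X -> forall c, In c (map fst l) -> c = Kzero k).
  { intros l Hnd Hl E.
    apply (power_sum_eq0 l Hnd); [reflexivity|].
    (* The combination of the [y_t] is the sum of the series of the [power_sum l i * z i], with an
       explicit error term. *)
    assert (Hcomb : forall n, bnorm X (vsub X (family_comb y l)
      (psum X (fun i => bscal X (power_sum l i) (z i)) n)) <= coef_mass l * (8 / 7 * rho n)).
    { intro n. clear Hnd E. induction l as [|[c t] l IH].
      - unfold family_comb; simpl.
        replace (vsub X _ _) with (bzero X); [rewrite bnorm_0; lra|].
        assert (E : psum X (fun i => bscal X (Kzero k) (z i)) n = bzero X).
        { induction n as [|n IH]; simpl; [reflexivity|]. rewrite IH. vcoefs; ring. }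
        unfold vsub. rewrite E. vcoefs; ring.
      - specialize (IH ltac:(intros; apply Hl; right; auto)).
        specialize (Hy t ltac:(apply Hl; left; auto) n).
        assert (E : psum X (fun i => bscal X (power_sum ((c, t) :: l) i) (z i)) n =
          badd X (bscal X c (psum X (fun i => bscal X (Kreal k (t ^ i)) (z i)) n))
            (psum X (fun i => bscal X (power_sum l i) (z i)) n)).
        { clear. induction n as [|n IH]; simpl in *; [vcoefs; ring|].
          rewrite IH. vcoefs; ring. }
        rewrite E. clear E. unfold family_comb in *. simpl.
        set (p1 := psum X (fun i => bscal X (Kreal k (t ^ i)) (z i)) n) in *.
        set (p2 := psum X (fun i => bscal X (power_sum l i) (z i)) n) in *.
        set (q := Xlincomb _) in *.
        replace (vsub X _ _) with (badd X (bscal X c (vsub X (y t) p1)) (vsub X q p2))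
          by (unfold vsub; vcoefs; ring).
        eapply Rle_trans; [apply bnorm_triangle|]. rewrite bnorm_scal.
        pose proof (Kabs_nonneg k c). nra. }
    set (b := power_sum l) in *. set (u := fun i => bscal X (b i) (z i)) in *.
    assert (Hlim : forall eps, 0 < eps -> exists N, forall n, (N <= n)%nat ->
      bnorm X (psum X u n) < eps).
    { intros eps He. pose proof (coef_mass_nonneg l) as Hm.
      destruct (@eighth_decay_vanishes rho (fun n => Rlt_le _ _ (Hrho n)) Hdec
        (eps / (2 * (coef_mass l + 1)))) as [N HN].
      { apply Rdiv_lt_0_compat; lra. }
      exists N. intros n Hn. specialize (HN n Hn). specialize (Hcomb n).
      rewrite E, bnorm_sub_sym in Hcomb.
      replace (vsub X (psum X u n) (bzero X)) with (psum X u n) in Hcomb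
        by (unfold vsub; vcoefs; ring).
      apply (Rmult_lt_compat_r (2 * (coef_mass l + 1))) in HN; [|lra].
      replace (eps / (2 * (coef_mass l + 1)) * (2 * (coef_mass l + 1))) with eps in HN
        by (field; lra).
      specialize (Hrho n). nra. }
    (* A bound [C] for the coefficients improves to [C / 7]: the tail of the series
       after the [n]th term is at most [delta n * C / 7]. *)
    assert (Hstep : forall C, (forall n, Kabs k (b n) <= C) -> forall n, Kabs k (b n) <= C / 7).
    { intros C HC n.
      assert (HC0 : 0 <= C) by (pose proof (Kabs_nonneg k (b n)); specialize (HC n); lra).
      specialize (Hcoef b n). fold u in Hcoef.
      assert (Htail : bnorm X (psum X u (S n)) <= 8 / 7 * (C * rho (S n))).
      { apply Rnot_lt_le; intro H.
        destruct (Hlim (bnorm X (psum X u (S n)) - 8 / 7 * (C * rho (S n)))) as [N HN]; [lra|].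
        specialize (HN (N + S n)%nat ltac:(lia)).
        pose proof (@psum_increment k X u (fun n => C * rho n)) as Hi.
        specialize (Hi ltac:(intro m; specialize (Hdec m); nra)).
        assert (Hu : forall m, bnorm X (u m) <= C * rho m).
        { intro m. unfold u. rewrite bnorm_scal. pose proof (bnorm_nonneg X (z m)).
          pose proof (Kabs_nonneg k (b m)). specialize (HC m). specialize (Hz m). nra. }
        specialize (Hi Hu (S n) N). rewrite bnorm_sub_sym in Hi.
        pose proof (bnorm_triangle X (vsub X (psum X u (S n)) (psum X u (N + S n)))
          (psum X u (N + S n))) as Ht.
        replace (badd X (vsub X (psum X u (S n)) (psum X u (N + S n))) (psum X u (N + S n)))
          with (psum X u (S n)) in Ht by (unfold vsub; vcoefs; ring).
        lra. }
      specialize (Hrd n). specialize (Hdelta n).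
      apply Rmult_le_reg_r with (delta n); [exact Hdelta|]. nra. }
    (* Iterating from the bound [coef_mass l]; the factor 1/7 is weakened to 1/2 to fit
       [pow2_bounded_eq0]. *)
    assert (Hiter : forall m n, 2 ^ m * Kabs k (b n) <= coef_mass l).
    { assert (H : forall m n, Kabs k (b n) <= coef_mass l / 2 ^ m).
      { induction m as [|m IH]; intro n.
        - unfold Rdiv. simpl. rewrite Rinv_1, Rmult_1_r. apply power_sum_bound, Hl.
        - pose proof (Hstep _ IH n) as H.
          assert (H2 : 0 < / 2 ^ m) by (apply Rinv_0_lt_compat, pow_lt; lra).
          pose proof (coef_mass_nonneg l).
          simpl. unfold Rdiv in *. rewrite Rinv_mult. nra. }
      intros m n. specialize (H m n). assert (H2 : 0 < 2 ^ m) by (apply pow_lt; lra).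
      apply (Rmult_le_compat_r (2 ^ m)) in H; [|lra].
      replace (coef_mass l / 2 ^ m * 2 ^ m) with (coef_mass l) in H by (field; lra). lra. }
    intro n. apply Kb_norm_eq0, pow2_bounded_eq0 with (coef_mass l); [apply Kabs_nonneg|].
    auto. }
  (* The vectors [y t] are controlled only for [|t| <= 1]; [atan t / 2] maps the reals injectively
     into this interval, because [PI <= 4]. *)
  exists (fun t => y (atan t / 2)). intros l Hnd E c Hc.
  apply (Hunit (map (fun ct => (fst ct, atan (snd ct) / 2)) l)).
  - rewrite map_map. simpl. rewrite <- (map_map snd (fun t => atan t / 2)).
    apply Injective_map_NoDup; [|exact Hnd].
    intros s t Est. rewrite <- (tan_atan s), <- (tan_atan t). f_equal. lra.
  - intros t Ht. rewrite map_map in Ht. apply in_map_iff in Ht as [ct [<- _]]. simpl.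
    pose proof (atan_bound (snd ct)). pose proof PI_4.
    apply Rabs_le. lra.
  - unfold family_comb in *. rewrite map_map. exact E.
  - rewrite map_map. exact Hc.
Qed.

End IndependentFamily.

(** * Hamel bases *)

Section Hamel.
Variables (k : Kind) (X : Banach k).
Add Ring Kring5 : (K_ring_theory k).

Lemma lincomb_app (l m : list (Kt k * (nat -> X))) :
  lincomb (l ++ m) = sadd (lincomb l) (lincomb m).
Proof.
  induction l as [|[c v] l IH]; simpl.
  - apply functional_extensionality; intro n. unfold sadd, szero. vcoefs; ring.
  - rewrite IH. apply functional_extensionality; intro n. unfold sadd. vcoefs; ring.
Qed.

Lemma lincomb_scal (d : Kt k) (l : list (Kt k * (nat -> X))) :
  lincomb (map (fun cv => (Kmul k d (fst cv), snd cv)) l) = sscal d (lincomb l).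
Proof.
  induction l as [|[c v] l IH]; simpl.
  - apply functional_extensionality; intro n. unfold sscal, szero. vcoefs; ring.
  - rewrite IH. apply functional_extensionality; intro n. unfold sadd, sscal. vcoefs; ring.
Qed.

(** This passes linear independence to unions of chains, since a linear relation involves finitely
    many vectors. *)
Lemma in_chain_union_list (T : Type) (C : (T -> Prop) -> Prop) (vs : list T) :
  (exists A, C A) ->
  (forall A B, C A -> C B -> (forall x, A x -> B x) \/ (forall x, B x -> A x)) ->
  (forall v, In v vs -> exists A, C A /\ A v) ->
  exists A, C A /\ forall v, In v vs -> A v.
Proof.
  intros Cne Ctot. induction vs as [|v vs IH]; intro H.
  - destruct Cne as [A CA]. exists A. split; [exact CA|contradiction].
  - destruct IH as [A [CA HA]]; [intros; apply H; right; auto|].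
    destruct (H v (or_introl eq_refl)) as [B [CB HB]].
    destruct (Ctot A B CA CB) as [HAB|HBA].
    + exists B. split; [exact CB|]. intros w [<-|Hw]; auto.
    + exists A. split; [exact CA|]. intros w [<-|Hw]; auto.
Qed.

(** A nonzero coefficient at [w] could be inverted, which would put [w] in the span of [B]; with
    that coefficient zero, a relation in [B] remains. *)
Lemma lin_indep_add (B : (nat -> X) -> Prop) (w : nat -> X) :
  lin_indep B ->
  ~ (exists l, (forall v, In v (map snd l) -> B v) /\ lincomb l = w) ->
  lin_indep (fun v => B v \/ v = w).
Proof.
  intros HB Hw l Hnd Hl E.
  destruct (classic (In w (map snd l))) as [Hin|Hin].
  - apply in_map_iff in Hin as [[c w'] [Ew Hin]]. simpl in Ew; subst w'.
    apply in_split in Hin as [l1 [l2 ->]].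
    assert (Hother : forall v, In v (map snd (l1 ++ l2)) -> B v).
    { intros v Hv. rewrite map_app in Hnd. simpl in Hnd.
      apply NoDup_remove_2 in Hnd. rewrite <- map_app in Hnd.
      destruct (Hl v) as [H| ->]; [|exact H|contradiction].
      rewrite map_app in *. simpl. apply in_app_iff in Hv. apply in_app_iff. simpl. tauto. }
    assert (E' : forall n, badd X (bscal X c (w n)) (lincomb (l1 ++ l2) n) = bzero X).
    { intro n. rewrite lincomb_app in E. apply (equal_f) with (x := n) in E.
      rewrite lincomb_app. cbn [lincomb] in E. unfold sadd, sscal, szero in *.
      rewrite <- E. vcoefs; ring. }
    assert (Hc : c = Kzero k).
    { apply NNPP; intro Hc. apply Hw. destruct (K_inverse k Hc) as [d Hd].
      exists (map (fun cv => (Kmul k (Kopp k d) (fst cv), snd cv)) (l1 ++ l2)). split.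
      - intros v Hv. rewrite map_map in Hv. auto.
      - rewrite lincomb_scal. apply functional_extensionality; intro n. unfold sscal.
        rewrite <- (bscal_1 X (w n)), <- Hd.
        apply vsub_eq0. rewrite <- (bscal_zero_r X (Kopp k d)), <- (E' n).
        unfold vsub. vcoefs; ring. }
    subst c.
    assert (Hrest : forall c, In c (map fst (l1 ++ l2)) -> c = Kzero k).
    { apply HB; [|exact Hother|].
      - rewrite map_app in *. simpl in Hnd. apply NoDup_remove_1 in Hnd. exact Hnd.
      - apply functional_extensionality; intro n. unfold szero. rewrite <- (E' n).
        vcoefs; ring. }
    intros c Hc. rewrite map_app in Hc. simpl in Hc.
    apply in_app_iff in Hc. rewrite map_app in Hrest.
    destruct Hc as [Hc|[<-|Hc]]; auto; apply Hrest, in_app_iff; auto.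
  - apply (HB l Hnd); [|exact E].
    intros v Hv. destruct (Hl v Hv) as [H| ->]; [exact H|contradiction].
Qed.

Lemma hamel_basis_extending (B0 S : (nat -> X) -> Prop) :
  (forall v, B0 v -> S v) -> lin_indep B0 ->
  exists B, hamel_basis B S /\ forall v, B0 v -> B v.
Proof.
  intros HS HB0.
  destruct (@zorn_subsets_above _
    (fun B : (nat -> X) -> Prop => (forall v, B v -> S v) /\ lin_indep B) B0)
    as [B [[BS Bind] [B0B Bmax]]].
  - auto.
  - intros C Cne CP Ctot. split.
    + intros v [A [CA HA]]. apply (proj1 (CP A CA)), HA.
    + intros l Hnd Hl E.
      destruct (in_chain_union_list C (map snd l) Cne Ctot Hl) as [A [CA HA]].
      apply (proj2 (CP A CA) l Hnd HA E).
  - exists B. split; [|exact B0B]. split; [exact BS|]. split; [exact Bind|].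
    intros w Hw. apply NNPP; intro Hn.
    assert (HBw : B w).
    { apply (Bmax (fun v => B v \/ v = w)); [split|auto|auto].
      - intros v [Hv| ->]; auto.
      - apply lin_indep_add; assumption. }
    apply Hn. exists ((Kone k, w) :: nil). split.
    + intros v [<-|[]]. exact HBw.
    + apply functional_extensionality; intro n. simpl. unfold sadd, sscal, szero.
      vcoefs; ring.
Qed.

Lemma spans_injects (B S : (nat -> X) -> Prop) :
  spans B S -> injects (sig S) (list (Kt k * sig B)).
Proof.
  intro H.
  destruct (@functional_choice (sig S) (list (Kt k * sig B)) (fun w l =>
    lincomb (map (fun cv => (fst cv, proj1_sig (snd cv))) l) = proj1_sig w)) as [f Hf].
  - intros [w Hw]. destruct (H w Hw) as [l [Hl E]]. simpl. subst w. clear Hw.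
    induction l as [|[c v] l IH].
    + exists nil. reflexivity.
    + destruct IH as [l' Hl']; [intros; apply Hl; right; auto|].
      exists ((c, exist _ v (Hl v (or_introl eq_refl))) :: l').
      simpl. rewrite Hl'. reflexivity.
  - exists f. intros w w' E. apply proj1_sig_inj. rewrite <- !Hf, E. reflexivity.
Qed.

(** Extend [B] to a basis [B'] of [S]. Then [B] injects into [B'], which is a set of sequences and
    so injects back into [B]; Cantor-Bernstein concludes. *)
Lemma same_dim_of_injects (B W S : (nat -> X) -> Prop) :
  (forall w, W w -> S w) -> hamel_basis B W -> injects (nat -> X) (sig B) -> same_dim W S.
Proof.
  intros HWS HB Hinj.
  destruct (@hamel_basis_extending B S) as [B' [HB' HBB']].
  - intros v Hv. apply HWS, HB, Hv.
  - apply HB.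
  - exists B, B'. split; [exact HB|]. split; [exact HB'|].
    apply cantor_bernstein.
    + exists (fun v => exist _ (proj1_sig v) (HBB' _ (proj2_sig v))).
      intros v w E. apply proj1_sig_inj. exact (f_equal (@proj1_sig _ _) E).
    + eapply injects_trans; [|exact Hinj].
      exists (@proj1_sig _ _). intros v w. apply proj1_sig_inj.
Qed.

(** * The space of the sequences [a \otimes x] *)

Variable a : nat -> Kt k.

Definition tensors (w : nat -> X) : Prop := exists x, w = ktensor a x.

Lemma tensors_subspace : lin_subspace tensors.
Proof.
  split; [|split].
  - exists (bzero X). apply functional_extensionality; intro n.
    unfold szero, ktensor. vcoefs; ring.
  - intros u v [x ->] [y ->]. exists (badd X x y). apply functional_extensionality; intro n.
    unfold sadd, ktensor. vcoefs; ring.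
  - intros c u [x ->]. exists (bscal X c x). apply functional_extensionality; intro n.
    unfold sscal, ktensor. vcoefs; ring.
Qed.

Lemma lincomb_ktensor (y : R -> X) (l : list (Kt k * R)) :
  lincomb (map (fun ct => (fst ct, ktensor a (y (snd ct)))) l) =
  ktensor a (family_comb X y l).
Proof.
  induction l as [|[c t] l IH]; simpl; apply functional_extensionality; intro n.
  - unfold szero, ktensor, family_comb. simpl. vcoefs; ring.
  - rewrite IH. unfold sadd, sscal, ktensor, family_comb. simpl. vcoefs; ring.
Qed.

Variable j : nat.
Hypothesis aj : a j <> Kzero k.

Lemma ktensor_eq0 (x : X) : ktensor a x = szero -> x = bzero X.
Proof. intro E. exact (bscal_cancel X x aj (equal_f E j)). Qed.

Lemma ktensor_inj (x y : X) : ktensor a x = ktensor a y -> x = y.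
Proof.
  intro E. apply vsub_eq0, ktensor_eq0. apply functional_extensionality; intro n.
  pose proof (equal_f E n) as En. unfold ktensor, vsub, szero in *.
  rewrite bscal_distr_v, En. vcoefs; ring.
Qed.

Lemma tensors_basis :
  infinite_dim X -> exists B, hamel_basis B tensors /\ injects (nat -> X) (sig B).
Proof.
  intro HX. destruct (exists_independent_family HX) as [y Hy].
  assert (yinj : forall s t, y s = y t -> s = t).
  { intros s t E. apply NNPP; intro Hst.
    assert (H : Kone k = Kzero k).
    { apply (Hy ((Kone k, s) :: (Kopp k (Kone k), t) :: nil)).
      - repeat constructor; simpl; intuition.
      - unfold family_comb. simpl. rewrite E. vcoefs; ring.
      - left; reflexivity. }
    apply (f_equal (Kabs k)) in H. rewrite Kabs_0, Kabs_1 in H. lra. }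
  set (B0 := fun v => exists t, v = ktensor a (y t)).
  destruct (@hamel_basis_extending B0 tensors) as [B [HB HB0]].
  - intros v [t ->]. exists (y t). reflexivity.
  - intros l Hnd Hl E.
    (* [tau] recovers a parameter of each vector of [B0], turning a relation in [B0] into one
       between the [y t]; outside [B0] it takes the default value 0. *)
    destruct (functional_choice (fun v t => B0 v -> v = ktensor a (y t))) as [tau Htau].
    { intro v. destruct (classic (B0 v)) as [[t Ht]|H]; [exists t; auto|exists 0; contradiction]. }
    set (l' := map (fun cv => (fst cv, tau (snd cv))) l).
    assert (El : l = map (fun ct => (fst ct, ktensor a (y (snd ct)))) l').
    { unfold l'. rewrite map_map. rewrite <- (map_id l) at 1. apply map_ext_in.
      intros [c v] Hin. simpl. rewrite <- Htau; [reflexivity|].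
      apply Hl. apply in_map_iff. exists (c, v). auto. }
    assert (Hnd' : NoDup (map snd l')).
    { rewrite El in Hnd. rewrite map_map in Hnd. simpl in Hnd.
      rewrite <- (map_map snd (fun t => ktensor a (y t))) in Hnd.
      apply NoDup_map_inv in Hnd. exact Hnd. }
    rewrite El in E. rewrite lincomb_ktensor in E.
    intros c Hc. apply (Hy l' Hnd' (ktensor_eq0 E)).
    unfold l'. rewrite map_map. exact Hc.
  - exists B. split; [exact HB|].
    assert (HR : injects R (sig B)).
    { exists (fun t => exist _ (ktensor a (y t)) (HB0 _ (ex_intro _ t eq_refl))).
      intros s t E. apply (f_equal (@proj1_sig _ _)) in E. apply yinj, ktensor_inj, E. }
    assert (Hnat : injects nat (sig B)).
    { eapply injects_trans; [|exact HR]. exists INR. intros m n. apply INR_eq. }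
    pose proof (injects_square Hnat) as Hsq.
    assert (HK : injects (Kt k) (sig B)).
    { eapply injects_trans; [apply K_injects_square|].
      eapply injects_trans; [exact (injects_prod HR HR)|exact Hsq]. }
    (* The injections are composed from [X^N] to [X], to [tensors], to lists over [K * B], to lists
       over [B], to [B]. *)
    eapply injects_trans; [apply injects_sequences_self|].
    apply injects_trans with (sig tensors).
    { exists (fun x => exist _ (ktensor a x) (ex_intro _ x eq_refl)).
      intros x x' E. apply (f_equal (@proj1_sig _ _)) in E. apply ktensor_inj, E. }
    eapply injects_trans; [apply spans_injects, HB|].
    eapply injects_trans; [|apply (injects_list Hnat)].
    apply injects_map_list. eapply injects_trans; [|exact Hsq].
    apply injects_prod; [exact HK|]. exists (fun v => v). intros v w; auto.
Qed.

End Hamel.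

(** * Closedness of the space of the sequences [a \otimes x] *)

Section Closedness.
Variables (k : Kind) (E : SeqFunctor k) (p : Gam E) (X : Banach k) (a : nat -> Kt k).
Variables (HX : infinite_dim X) (Ea : Esp E p (Kban k) a) (j : nat) (aj : a j <> Kzero k).
Add Ring Kring6 : (K_ring_theory k).

Lemma Esp_ktensor (x : X) : Esp E p X (ktensor a x).
Proof.
  destruct (classic (x = bzero X)) as [->|Hx].
  - replace (ktensor a (bzero X)) with (@szero k X); [apply Esp_subspace|].
    apply functional_extensionality; intro n. unfold szero, ktensor. vcoefs; ring.
  - apply ax_b; assumption.
Qed.

(** By translation invariance and (c1), [x |-> a \otimes x] distorts distances by factors between
    [L * d(a, 0)] and [M * d(a, 0)]. The lower one makes the preimages of approximants Cauchy,
    completeness of [X] gives a limit [l], and the upper one identifies [w] with [a \otimes l]. *)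
Lemma tensors_closed_metric : is_metric E = true -> closed_in E p X (tensors X a).
Proof.
  intros Hm w Hw Hcl. unfold in_closure in Hcl. rewrite Hm in Hcl.
  destruct (ax_a1 E Hm p X) as [[Hd Htri] [Hinv _]].
  destruct (ax_a1 E Hm p (Kban k)) as [[HdK _] _].
  destruct (ax_c1 E Hm p X HX) as [L [M [HL [HM Hc]]]].
  set (d := edist E p X) in *. set (da := edist E p (Kban k) a szero) in *.
  assert (Hda : 0 < da).
  { destruct (HdK a szero Ea (proj1 (Esp_subspace E p (Kban k)))) as [[H|H] [H0 _]];
      [exact H|]. exfalso. apply aj. rewrite (proj1 H0 (eq_sym H)). reflexivity. }
  assert (Hdiff : forall x y, d (ktensor a x) (ktensor a y) = d (ktensor a (vsub X x y)) szero).
  { intros x y.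
    rewrite <- (Hinv (ktensor a (vsub X x y)) szero (ktensor a y));
      [|apply Esp_ktensor|apply Esp_subspace|apply Esp_ktensor].
    unfold d. f_equal; apply functional_extensionality; intro n;
      unfold sadd, szero, ktensor, vsub; vcoefs; ring. }
  assert (Happ : forall n : nat, exists x, d w (ktensor a x) < / INR (S n)).
  { intro n. destruct (Hcl (/ INR (S n))) as [y [[x ->] H]]; [|exists x; exact H].
    apply Rinv_0_lt_compat, lt_0_INR; lia. }
  destruct (functional_choice _ Happ) as [x Hx]. clear Happ.
  assert (Hsmall : forall eps, 0 < eps -> exists N, forall n, (N <= n)%nat ->
    d w (ktensor a (x n)) < eps).
  { intros eps He. destruct (archimed_cor1 eps He) as [N [HN HN0]].
    exists N. intros n Hn. eapply Rlt_trans; [apply Hx|].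
    eapply Rle_lt_trans; [|exact HN]. apply Rinv_le_contravar.
    - apply lt_0_INR; lia.
    - apply le_INR; lia. }
  destruct (bcomplete X x) as [l Hl].
  { intros eps He. destruct (Hsmall (eps * (L * da) / 2)) as [N HN].
    { assert (0 < L * da) by nra. nra. }
    exists N. intros m n Hmn Hn. fold (vsub X (x m) (x n)).
    apply Rmult_lt_reg_r with (L * da); [nra|].
    pose proof (proj1 (Hc a (vsub X (x m) (x n)) Ea)) as H1.
    fold d in H1. fold da in H1. rewrite <- Hdiff in H1.
    pose proof (Htri _ _ _ (Esp_ktensor (x m)) Hw (Esp_ktensor (x n))) as H2.
    destruct (Hd _ _ (Esp_ktensor (x m)) Hw) as [_ [_ Hs]]. rewrite Hs in H2.
    pose proof (HN m Hmn). pose proof (HN n Hn). nra. }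
  exists l. apply (Hd w (ktensor a l) Hw (Esp_ktensor l)).
  apply NNPP; intro Hn.
  destruct (Hd w (ktensor a l) Hw (Esp_ktensor l)) as [Hge _].
  (* If [D] were positive, some [a \otimes x n] would be closer than [D / 2] to both [w] and
     [a \otimes l]. *)
  set (D := d w (ktensor a l)) in *.
  destruct (Hsmall (D / 2)) as [N1 HN1]; [lra|].
  destruct (Hl (D / 2 / (M * da))) as [N2 HN2].
  { apply Rdiv_lt_0_compat; nra. }
  set (n := Nat.max N1 N2).
  specialize (HN1 n ltac:(lia)). specialize (HN2 n ltac:(lia)).
  fold (vsub X (x n) l) in HN2.
  pose proof (proj2 (Hc a (vsub X (x n) l) Ea)) as H1.
  fold d in H1. fold da in H1. rewrite <- Hdiff in H1.
  pose proof (Htri _ _ _ Hw (Esp_ktensor (x n)) (Esp_ktensor l)) as H2. fold D in H2.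
  assert (HMd : 0 < M * da) by nra.
  apply (Rmult_lt_compat_r (M * da)) in HN2; [|exact HMd].
  replace (D / 2 / (M * da) * (M * da)) with (D / 2) in HN2 by (field; lra).
  nra.
Qed.

(* The limit must be [w j / a j], since the coordinates are controlled by a seminorm. *)
Lemma tensors_closed_seminorms : is_metric E = false -> closed_in E p X (tensors X a).
Proof.
  intros Hm w Hw Hcl. unfold in_closure in Hcl. rewrite Hm in Hcl.
  destruct (ax_c2 E Hm p X HX) as [C [i [HC Hco]]].
  (* A single seminorm bounds all coordinates, so one [x] approximates every [w n] at once. *)
  assert (Happ : forall eps, 0 < eps -> exists x, forall n,
    bnorm X (vsub X (bscal X (a n) x) (w n)) <= C * eps).
  { intros eps He. destruct (Hcl (i :: nil) eps He) as [y [[x ->] H]].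
    exists x. intro n. specialize (H i (or_introl eq_refl)).
    eapply Rle_trans; [apply (Hco (sadd (ktensor a x) (sopp w)) n)|].
    - replace (sopp w) with (sscal (Kopp k (Kone k)) w).
      + destruct (Esp_subspace E p X) as [_ [Hadd Hscal]].
        apply Hadd; [apply Esp_ktensor|apply Hscal, Hw].
      + apply functional_extensionality; intro m. unfold sscal, sopp. vcoefs; ring.
    - apply Rmult_le_compat_l; lra. }
  destruct (K_inverse k aj) as [d Hd].
  exists (bscal X d (w j)). apply functional_extensionality; intro n.
  apply bnorm_small_eq. intros eps He. unfold ktensor.
  (* As [q = a n / a j], the multiples of [x] cancel in [q * (a j * x - w j) - (a n * x - w n) = w n
     - q * w j]. The two errors add up to at most [(1 + |q|) * C] times the tolerance, whence the
     choice of tolerance below. *)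
  set (q := Kmul k (a n) d).
  pose proof (Kabs_nonneg k q) as Hq.
  destruct (Happ (eps / (C * (1 + Kabs k q)))) as [x Hx].
  { apply Rdiv_lt_0_compat; nra. }
  replace (vsub X (w n) (bscal X (a n) (bscal X d (w j)))) with
    (badd X (bscal X q (vsub X (bscal X (a j) x) (w j))) (bopp X (vsub X (bscal X (a n) x) (w n)))).
  - eapply Rle_trans; [apply bnorm_triangle|]. rewrite bnorm_opp, bnorm_scal.
    pose proof (Hx j) as H1. pose proof (Hx n) as H2.
    replace (C * (eps / (C * (1 + Kabs k q)))) with (eps / (1 + Kabs k q)) in H1, H2
      by (field; lra).
    apply (Rmult_le_compat_l (Kabs k q)) in H1; [|exact Hq].
    replace eps with (Kabs k q * (eps / (1 + Kabs k q)) + eps / (1 + Kabs k q))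
      by (field; lra).
    lra.
  - assert (Eq : Kmul k q (a j) = a n).
    { unfold q. transitivity (Kmul k (a n) (Kmul k d (a j))); [ring|]. rewrite Hd. ring. }
    replace (bscal X (a n) x) with (bscal X (Kmul k q (a j)) x) by (rewrite Eq; reflexivity).
    unfold vsub, q. vcoefs; ring.
Qed.

Lemma tensors_closed : closed_in E p X (tensors X a).
Proof.
  destruct (is_metric E) eqn:Hm;
    [apply tensors_closed_metric|apply tensors_closed_seminorms]; exact Hm.
Qed.

End Closedness.

Theorem theorem1 (k : Kind) (E F : SeqFunctor k) (X : Banach k) :
  infinite_dim X ->
  (exists a : nat -> Kt k,
      (forall r : Gam E, Esp E r (Kban k) a) /\ ~ (exists q : Gam F, Esp F q (Kban k) a)) ->
  forall p : Gam E,
    maximal_spaceable E p X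
      (fun w => (forall r : Gam E, Esp E r X w) /\ ~ (exists q : Gam F, Esp F q X w)).
Proof.
  intros HX [a [Ea Fa]] p.
  (* The sequence [a] is nonzero: the zero sequence lies in every [F(q, K)], and there is at least
     one index [q]. *)
  destruct (classic (exists j, a j <> Kzero k)) as [[j aj]|Ha].
  2: { exfalso. apply Fa. destruct (Gam_inh F) as [q]. exists q.
       replace a with (@szero k (Kban k)); [apply Esp_subspace|].
       apply functional_extensionality; intro n. apply NNPP; intro H.
       apply Ha. exists n. intro E0. apply H. rewrite E0. reflexivity. }
  exists (tensors X a). split; [|split; [|split; [|split]]].
  - intros w [x ->]. apply Esp_ktensor, Ea.
  - apply tensors_subspace.
  - exact (tensors_closed E p a HX (Ea p) j aj).
  (* For nonzero [x], axiom (b) for [F] would bring [a \otimes x] in [F(q, X)] back to [a] in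
     [F(q, K)]. *)
  - intros w [x ->]. destruct (classic (x = bzero X)) as [->|Hx].
    + right. apply functional_extensionality; intro n. apply bscal_zero_r.
    + left. split.
      * intro r. apply Esp_ktensor, Ea.
      * intros [q Hq]. apply Fa. exists q. apply (ax_b F q X a x Hx), Hq.
  - destruct (tensors_basis a j aj HX) as [B [HB Hinj]].
    apply (@same_dim_of_injects k X B); [|exact HB|exact Hinj].
    intros w [x ->]. apply Esp_ktensor, Ea.
Qed.
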